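(* Let $G$ be a Lie group and let $E=E(g,\mu,\xi,\nu)$ be a Lagrangian on $TT^*G\simeq(G\circledS\mathfrak g_1^* )\circledS(\mathfrak g_2\circledS\mathfrak g_3^* )$. The extremals of the action integral $\int_a^bE(g,\mu,\xi,\nu)\,dt$, for the variations $$\delta g=T_eR_g\eta,\quad\delta\mu=\lambda+\mathrm{ad}^*_\eta\mu,\quad\delta\xi=\dot\eta+[\eta,\xi],\quad\delta\nu=\dot\lambda+\mathrm{ad}^*_\eta\nu-\mathrm{ad}^*_\xi\lambda$$ with arbitrary $(\eta,\lambda)\in\mathfrak g\circledS\mathfrak g^*$ (curves vanishing at the end points), are defined by the trivialized Euler-Lagrange equations $$\frac{d}{dt}\Big(\frac{\delta E}{\delta\xi}\Big)=T_e^*R_g\Big(\frac{\delta E}{\delta g}\Big)-\mathrm{ad}^*_{\frac{\delta E}{\delta\mu}}\mu+\mathrm{ad}^*_\xi\Big(\frac{\delta E}{\delta\xi}\Big)-\mathrm{ad}^*_{\frac{\delta E}{\delta\nu}}\nu,\qquad\frac{d}{dt}\Big(\frac{\delta E}{\delta\nu}\Big)=\frac{\delta E}{\delta\mu}+\mathrm{ad}_\xi\frac{\delta E}{\delta\nu}.$$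
   Context: $G$ is a (finite-dimensional) Lie group with identity $e$, $\mathfrak g=T_eG$; $\mathfrak g_i,\mathfrak g_i^*$ are copies of $\mathfrak g,\mathfrak g^*$. $R_g$ is right multiplication, $T_e^*R_g:T_g^*G\to\mathfrak g^*$ the dual of $T_eR_g$; $\mathrm{Ad}_g=T_e(h\mapsto ghg^{-1})$, $\mathrm{ad}_\xi\eta=[\xi,\eta]=\frac{d}{dt}|_{t=0}\mathrm{Ad}_{\exp t\xi}\eta$, $\langle\mathrm{ad}^*_\xi\mu,\eta\rangle=-\langle\mu,[\xi,\eta]\rangle$. $T^*G$ is identified with $G\circledS\mathfrak g^*$ by $\alpha_g\mapsto(g,T_e^*R_g\alpha_g)$. $TT^*G=T(G\circledS\mathfrak g^* )$ is identified with $G\times\mathfrak g_1^*\times\mathfrak g_2\times\mathfrak g_3^*$ by sending $(V_g,V_\mu)$ at $(g,\mu)$ to $(g,\mu,\xi,\nu)$, $\xi=T_gR_{g^{-1}}V_g$, $\nu=V_\mu-\mathrm{ad}^*_\xi\mu$. Thus along a curve $(g(t),\mu(t))$ in $G\circledS\mathfrak g^*$ one has $\dot g=T_eR_g\xi$ and $\dot\mu=\nu+\mathrm{ad}^*_\xi\mu$. $\frac{\delta E}{\delta g}\in T_g^*G$, $\frac{\delta E}{\delta\mu},\frac{\delta E}{\delta\nu}\in\mathfrak g$, $\frac{\delta E}{\delta\xi}\in\mathfrak g^*$ are partial derivatives. *)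

(* Defs.v *)
From HB Require Import structures.
From mathcomp Require Import all_boot all_order all_algebra.
From mathcomp Require Import all_classical all_reals all_analysis.

Set Implicit Arguments.
Unset Strict Implicit.
Unset Printing Implicit Defensive.
Import Order.TTheory GRing.Theory Num.Theory.
Import numFieldNormedType.Exports.
Local Open Scope classical_set_scope.
Local Open Scope ring_scope.

(* [f] is C^k on [U].  The domains used below are finite-dimensional, so that
   "all x |-> 'd f x v are C^k" is the same as "x |-> 'd f x is C^k".         *)
Fixpoint Ck_on (R : realType) (V W : normedModType R) (k : nat)
    (U : set V) (f : V -> W) {struct k} : Prop :=
  match k with
  | 0 => forall x, U x -> {for x, continuous f}
  | k'.+1 => (forall x, U x -> differentiable f x) /\
             (forall v, Ck_on k' U (fun x => 'd f x v))
  end.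

Definition Cinfty_on (R : realType) (V W : normedModType R)
    (U : set V) (f : V -> W) : Prop := forall k, Ck_on k U f.

(* Each point [x] of [T] comes with a preferred chart: its domain
   [chart_dom x], the chart [chart x] and the inverse chart [chart_inv x], the
   last two being relevant only on the domain and on its image.  These charts
   form the atlas of [T].  All tangent spaces are copies of [V]: T_xT is read
   in the preferred chart of [x].                                             *)
Record charted (R : realType) (T : topologicalType) (V : normedModType R) :=
  Charted {
    chart_dom : T -> set T;
    chart : T -> T -> V;
    chart_inv : T -> V -> T }.

Definition id_charted (R : realType) (V : normedModType R) : charted V V :=
  Charted (fun _ => setT) (fun _ => id) (fun _ => id).

Definition prod_charted (R : realType) (T1 T2 : topologicalType)
    (V1 V2 : normedModType R) (C1 : charted T1 V1) (C2 : charted T2 V2) :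
    charted (T1 * T2)%type (V1 * V2)%type :=
  Charted (fun p => chart_dom C1 p.1 `*` chart_dom C2 p.2)
          (fun p q => (chart C1 p.1 q.1, chart C2 p.2 q.2))
          (fun p v => (chart_inv C1 p.1 v.1, chart_inv C2 p.2 v.2)).

Record is_manifold (R : realType) (T : topologicalType) (V : normedModType R)
    (C : charted T V) : Prop := IsManifold {
  manifold_hausdorff : hausdorff_space T;
  manifold_countable : @second_countable T;
  chart_dom_mem : forall x, chart_dom C x x;
  chart_dom_open : forall x, open (chart_dom C x);
  chart_image_open : forall x, open (chart C x @` chart_dom C x);
  chartK : forall x y, chart_dom C x y -> chart_inv C x (chart C x y) = y;
  chart_continuous : forall x y, chart_dom C x y ->
    {for y, continuous (chart C x)};
  chart_inv_continuous : forall x v, (chart C x @` chart_dom C x) v ->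
    {for v, continuous (chart_inv C x)};
  chart_transition : forall x y,
    Cinfty_on (chart C x @` (chart_dom C x `&` chart_dom C y))
              (chart C y \o chart_inv C x) }.

Section Maps.
Variables (R : realType) (T1 T2 : topologicalType) (V1 V2 : normedModType R).
Variables (C1 : charted T1 V1) (C2 : charted T2 V2).

Definition in_charts (f : T1 -> T2) (x : T1) : V1 -> V2 :=
  chart C2 (f x) \o f \o chart_inv C1 x.

(* smoothness on a neighbourhood of [x] *)
Definition smooth_at (f : T1 -> T2) (x : T1) : Prop :=
  {for x, continuous f} /\
  exists2 U : set V1, open_nbhs (chart C1 x x) U & Cinfty_on U (in_charts f x).

(* T_x f : T_xT1 -> T_{f x}T2 *)
Definition tangent (f : T1 -> T2) (x : T1) : V1 -> V2 :=
  'd (in_charts f x) (chart C1 x x).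

End Maps.

#[short(type="topGroupType")]
HB.structure Definition TopGroup := {G of Group G & Topological G}.

(* Finite-dimensional Lie groups: the model space is R^n, written as the row
   vectors. *)
Record lieGroup (R : realType) (n : nat) (G : topGroupType) := LieGroup {
  lie_charts :> charted G 'rV[R]_n;
  lie_manifold : is_manifold lie_charts;
  lie_mul_smooth : forall p : G * G,
    smooth_at (prod_charted lie_charts lie_charts) lie_charts
              (fun q => (q.1 * q.2)%g) p;
  lie_inv_smooth : forall h : G,
    smooth_at lie_charts lie_charts (fun q => q^-1%g) h }.

Section Dual.
Variables (R : realType) (n : nat).

(* The dual of 'rV[R]_n is represented by 'cV[R]_n via this pairing; the
   bidual is 'rV[R]_n again. *)
Definition pairing (alpha : 'cV[R]_n) (v : 'rV[R]_n) : R := (v *m alpha) 0 0.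

Definition covec (L : 'rV[R]_n -> R) : 'cV[R]_n := \col_i L (delta_mx 0 i).
Definition bidual_vec (L : 'cV[R]_n -> R) : 'rV[R]_n :=
  \row_i L (delta_mx i 0).

Definition dual_map (A : 'rV[R]_n -> 'rV[R]_n) (alpha : 'cV[R]_n) : 'cV[R]_n :=
  covec (fun v => pairing alpha (A v)).

End Dual.

Section LieGroupTheory.
Variables (R : realType) (n : nat) (G : topGroupType) (L : lieGroup R n G).
Local Notation lie := 'rV[R]_n.
Local Notation dlie := 'cV[R]_n.

Definition velocity (c : R -> G) (t : R) : lie :=
  tangent (id_charted R) L c t 1.

(* T_e R_g : Lie algebra -> T_gG *)
Definition TR (g : G) : lie -> lie := tangent L L (fun h : G => (h * g)%g) 1%g.
(* T_e^* R_g : T_g^*G -> dual of the Lie algebra *)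
Definition TRdual (g : G) : dlie -> dlie := dual_map (TR g).

Definition Ad (g : G) : lie -> lie :=
  tangent L L (fun h : G => (g * h * g^-1)%g) 1%g.

Definition is_one_param (c : R -> G) (xi : lie) : Prop :=
  [/\ forall s t, c (s + t) = (c s * c t)%g,
      forall t, smooth_at (id_charted R) L c t
    & velocity c 0 = xi].

Definition is_exp (ex : lie -> G) : Prop :=
  forall xi, is_one_param (fun t => ex (t *: xi)) xi.

(* the exponential map of G, the unique map satisfying [is_exp] *)
Definition lie_exp : lie -> G := xget (fun _ => 1%g) is_exp.

(* ad xi eta is the Lie bracket [xi, eta] *)
Definition ad (xi eta : lie) : lie :=
  derive1 (fun t : R => Ad (lie_exp (t *: xi)) eta) 0.

(* <ad^*_xi mu, eta> = - <mu, [xi, eta]>, with a minus sign *)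
Definition coad (xi : lie) (mu : dlie) : dlie := - dual_map (ad xi) mu.

(* TT^*G in the right trivialization, with elements (g, mu, xi, nu) *)
Definition TTdual : Type := (G * dlie * lie * dlie)%type.

Definition TTdual_charts :=
  prod_charted
    (prod_charted (prod_charted L (id_charted dlie)) (id_charted lie))
    (id_charted dlie).

Definition smooth_lagrangian (E : TTdual -> R) : Prop :=
  forall p, smooth_at TTdual_charts (id_charted R) E p.

Definition smooth_curve (V : normedModType R) (a b : R) (c : R -> V) : Prop :=
  forall t, a <= t <= b -> smooth_at (id_charted R) (id_charted V) c t.

Definition smooth_group_curve (a b : R) (c : R -> G) : Prop :=
  forall t, a <= t <= b -> smooth_at (id_charted R) L c t.

Section PartialDerivatives.
Variables (E : TTdual -> R) (p : TTdual).
Let g := p.1.1.1.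
Let mu := p.1.1.2.
Let xi := p.1.2.
Let nu := p.2.

Definition dE_dg : dlie :=
  covec (tangent L (id_charted R) (fun h : G => E (h, mu, xi, nu) : R) g).
Definition dE_dmu : lie :=
  bidual_vec ('d (fun m : dlie => E (g, m, xi, nu) : R) mu).
Definition dE_dxi : dlie :=
  covec ('d (fun x : lie => E (g, mu, x, nu) : R) xi).
Definition dE_dnu : lie :=
  bidual_vec ('d (fun m : dlie => E (g, mu, xi, m) : R) nu).

End PartialDerivatives.

Section Variations.
Variables (E : TTdual -> R) (a b : R).
Variables (g : R -> G) (mu : R -> dlie) (xi : R -> lie) (nu : R -> dlie).

Definition action (x : R -> TTdual) : R :=
  \int[lebesgue_measure]_(t in `[a, b]) E (x t).

(* [X eps] is a deformation, smooth in (eps, t), of the given curve [X 0] whose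
   eps-derivative at 0 is the variation generated by (eta, lambda). *)
Record is_deformation (eta : R -> lie) (lambda : R -> dlie)
    (X : R -> R -> TTdual) : Prop := IsDeformation {
  deformation_smooth : forall t, a <= t <= b ->
    smooth_at (id_charted (R * R)%type) TTdual_charts
              (fun q : R * R => X q.1 q.2) (0, t);
  deformation_0 : forall t, a <= t <= b -> X 0 t = (g t, mu t, xi t, nu t);
  deformation_g : forall t, a <= t <= b ->
    velocity (fun eps => (X eps t).1.1.1) 0 = TR (g t) (eta t);
  deformation_mu : forall t, a <= t <= b ->
    is_derive (0 : R) 1 (fun eps => (X eps t).1.1.2)
      (lambda t + coad (eta t) (mu t));
  deformation_xi : forall t, a <= t <= b ->
    is_derive (0 : R) 1 (fun eps => (X eps t).1.2)
      (derive1 eta t + ad (eta t) (xi t));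
  deformation_nu : forall t, a <= t <= b ->
    is_derive (0 : R) 1 (fun eps => (X eps t).2)
      (derive1 lambda t + coad (eta t) (nu t) - coad (xi t) (lambda t)) }.

Definition is_extremal : Prop :=
  forall (eta : R -> lie) (lambda : R -> dlie),
    smooth_curve a b eta -> smooth_curve a b lambda ->
    eta a = 0 -> eta b = 0 -> lambda a = 0 -> lambda b = 0 ->
  forall X : R -> R -> TTdual, is_deformation eta lambda X ->
    is_derive (0 : R) 1 (fun eps => action (X eps)) 0.

End Variations.

End LieGroupTheory.

(* Main.v *)
(* In a chart at the identity, [ad xi eta] is the mixed derivative at the base
   point of the conjugation map phi(u, w) = u w u^-1, hence bilinear, and it is
   alternating because phi(u, u) = u, phi(e, w) = w and phi(u, e) = e.  (If no
   exponential map exists, [lie_exp] is constant and [ad] vanishes.)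
   Differentiating under the integral sign, the first variation of the action
   is the integral of dE applied to the prescribed variation.  By antisymmetry
   of [ad] this integrand differs from
     <residual_xi, eta> + <lambda, residual_nu>
   by the derivative of <dE/dxi, eta> + <lambda, dE/dnu>, which integrates to 0;
   the residuals are the differences of the two sides of the Euler-Lagrange
   equations.  Conversely the residuals are smooth, so they may be used as test
   variations after multiplication by (t - a)(b - t), and the resulting
   nonnegative integrand must vanish. *)
Require Import Defs.
From HB Require Import structures.
From mathcomp Require Import all_boot all_order all_algebra.
From mathcomp Require Import all_classical all_reals all_analysis.
From mathcomp Require Import ring.
Import Order.TTheory GRing.Theory Num.Theory.
Import numFieldNormedType.Exports.
Local Open Scope classical_set_scope.
Local Open Scope ring_scope.

Set Implicit Arguments.
Unset Strict Implicit.
Unset Printing Implicit Defensive.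

(** * Calculus of C^k maps *)

Section DiffExtra.
Variable R : realType.
Implicit Types V W : normedModType R.

(** The main obstacle is that a tangent space is read in the preferred chart of its base point, and
    this chart may jump from one point to the next. For derivatives at a single point this is
    harmless: the charts of a composite match. Along t -> g(t), however, the covector [dE_dg] may be
    discontinuous in t. What is smooth is its pull-back by [TRdual]: right translation by g(t)
    brings every base point to the identity, where one chart serves all t, and the partial
    derivatives of E become fixed-direction derivatives of a single map on a normed space.

    A pair of test curves tells something only if an actual deformation realizes it. The group slot
    of that deformation is a straight line in the chart at the identity, translated by g(t); the
    other slots are affine in eps.

    A deformation is controlled only near each point (0, t). Compactness of [a, b] yields one
    eps-window and one bound valid for all t, as differentiation under the integral sign
    requires. *)

Lemma near_eq_is_diff V W (f g : V -> W) (x : V) :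
  {near x, f =1 g} -> differentiable f x -> is_diff x g ('d f x).
Proof.
move=> fg df.
have gx : f x = g x by exact: (nbhs_singleton fg).
have H : continuous ('d f x) /\ g \o shift x = cst (g x) + 'd f x +o_ 0 id.
  split; first exact: diff_continuous.
  apply/eqaddoP => _/posnumP[e].
  have /diff_locally/eqaddoP/(_ e%:num)/(_ [gt0 of e%:num]) := df.
  apply: filter_app.
  have : \forall y \near 0, f (y + x) = g (y + x).
    by have := fg; rewrite (near_shift 0) /= subr0.
  apply: filter_app; near=> y => fgy.
  by rewrite !fctE /= fgy gx.
have dgf : 'd g x = 'd f x :> (V -> W) by apply: diff_unique; case: H.
apply: DiffDef => //.
by apply/diff_locallyP; rewrite dgf.
Unshelve. all: by end_near. Qed.

Lemma is_diff_lin V W (f : {linear V -> W}) (x : V) :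
  continuous f -> is_diff x f f.
Proof.
by move=> cf; apply: DiffDef; [exact: linear_differentiable|rewrite diff_lin].
Qed.

Lemma scale_is_bilinear W :
  bilinear_for
    (GRing.Scale.Law.clone _ _ *:%R _) (GRing.Scale.Law.clone _ _ *:%R _)
    (@GRing.scale R W).
Proof.
split=> [u'|u] a x y /=; first by rewrite scalerDl scalerA.
by rewrite scalerDr !scalerA mulrC.
Qed.

(** Scaling is bilinear and continuous, so the product rule is the chain rule through the pair of
    [f] and [g]. *)
Lemma is_diff_scale V W (f : V -> R) (g : V -> W) (df : V -> R) (dg : V -> W) x :
  is_diff x f df -> is_diff x g dg ->
  is_diff x (fun y => f y *: g y) (fun v => f x *: dg v + df v *: g x).
Proof.
move=> dfx dgx.
pose bM := @bilinear_isBilinear.Build R R W W _ _ (@GRing.scale R W)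
  (scale_is_bilinear W).
pose B : {bilinear R -> W -> W} := HB.pack (@GRing.scale R W) bM.
have cB : continuous (fun p : R * W => B p.1 p.2).
  by move=> p; apply: scale_continuous.
have dB : is_diff (f x, g x) (fun p : R * W => B p.1 p.2)
    (fun q => B (f x) q.2 + B q.1 (g x)).
  by apply: DiffDef; [exact: differentiable_bilin|exact: diff_bilin].
exact: (is_diff_comp (is_diff_pair dfx dgx) dB).
Qed.

Lemma is_diff_linear_comb V W (a : R) (f g df dg : V -> W) x :
  is_diff x f df -> is_diff x g dg ->
  is_diff x (fun y => a *: f y + g y) (fun v => a *: df v + dg v).
Proof. by move=> dfx dgx; exact: (is_diffD (is_diffZ a dfx) dgx). Qed.

End DiffExtra.

Section CkTheory.
Variable R : realType.
Implicit Types V W : normedModType R.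

Lemma is_diffP V W (f df : V -> W) x : is_diff x f df ->
  differentiable f x /\ forall v, 'd f x v = df v.
Proof. by case=> ? ->. Qed.

Lemma Ck_onW V W k (U : set V) (f : V -> W) : Ck_on k.+1 U f -> Ck_on k U f.
Proof.
elim: k f => [|k IH] f [df ckf]; first by move=> x /df/differentiable_continuous.
by split=> // v; exact/IH/ckf.
Qed.

Lemma Ck_on_subset V W k (U U' : set V) (f : V -> W) :
  U' `<=` U -> Ck_on k U f -> Ck_on k U' f.
Proof.
move=> sU; elim: k f => [|k IH] f /=; first by move=> cf x /sU/cf.
by case=> df ckf; split=> [x /sU/df//|v]; exact: IH.
Qed.

(** Openness is what lets the differential at a point of [U] depend only on the values taken in
    [U]. *)
Lemma eq_Ck_on V W k (U : set V) (f g : V -> W) : open U ->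
  (forall x, U x -> f x = g x) -> Ck_on k U f -> Ck_on k U g.
Proof.
move=> oU; elim: k f g => [|k IH] f g fg.
  move=> cf x Ux; rewrite /prop_for /continuous_at -(fg x Ux).
  apply: cvg_trans (cf x Ux); apply: near_eq_cvg.
  by apply: filterS (open_nbhs_nbhs (conj oU Ux)) => y Uy; rewrite fg.
case=> df ckf.
have fgd x : U x -> is_diff x g ('d f x).
  move=> Ux; apply: near_eq_is_diff (df _ Ux).
  by apply: filterS (open_nbhs_nbhs (conj oU Ux)) => y Uy; rewrite fg.
split=> [x /fgd[]//|v]; apply: IH (ckf v) => x Ux.
by have [_ ->] := is_diffP (fgd x Ux).
Qed.

(* The form in which derivatives are computed below: a Ck.+1 map is one with
   Ck directional derivatives, whatever expression they are given by. *)
Lemma Ck_onS V W k (U : set V) (f : V -> W) (df : V -> V -> W) : open U ->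
  (forall x, U x -> is_diff x f (df x)) ->
  (forall v, Ck_on k U (df ^~ v)) -> Ck_on k.+1 U f.
Proof.
move=> oU dfP ck; split=> [x /dfP[]//|v]; apply: eq_Ck_on (ck v) => // x Ux.
by have [_ ->] := is_diffP (dfP x Ux).
Qed.

Lemma Ck_on_diff V W k (U : set V) (f : V -> W) x :
  Ck_on k.+1 U f -> U x -> is_diff x f ('d f x).
Proof. by case=> df _ /df dfx; exact: differentiableP. Qed.

Lemma Ck_on_d V W k (U : set V) (f : V -> W) v :
  Ck_on k.+1 U f -> Ck_on k U (fun x => 'd f x v).
Proof. by case=> _; apply. Qed.

Lemma Ck_on_cst V W k (U : set V) (w : W) : Ck_on k U (cst w).
Proof.
elim: k w => [|k IH] w; first by move=> x _; exact: cvg_cst.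
split=> [x _|v]; first exact: differentiable_cst.
rewrite (_ : (fun x => _) = cst 0); first exact: IH.
by apply/funext => x; rewrite diff_cst.
Qed.

Lemma Ck_on_lin V W k (U : set V) (f : {linear V -> W}) :
  continuous f -> Ck_on k U f.
Proof.
case: k => [|k] cf; first by move=> x _; exact: cf.
split=> [x _|v]; first exact: linear_differentiable.
rewrite (_ : (fun x => _) = cst (f v)); first exact: Ck_on_cst.
by apply/funext => x; rewrite diff_lin.
Qed.

Lemma Ck_on_add V W k (U : set V) (f g : V -> W) : open U ->
  Ck_on k U f -> Ck_on k U g -> Ck_on k U (fun x => f x + g x).
Proof.
move=> oU; elim: k f g => [|k IH] f g.
  by move=> cf cg x Ux; exact: (cvgD (cf x Ux) (cg x Ux)).
move=> ckf ckg; apply: (@Ck_onS _ _ _ _ _ (fun x v => 'd f x v + 'd g x v)) => //.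
  by move=> x Ux; apply: is_diffD; [exact: Ck_on_diff ckf Ux|exact: Ck_on_diff ckg Ux].
by move=> v; apply: IH; exact: Ck_on_d.
Qed.

Lemma Ck_on_pair V W1 W2 k (U : set V) (f : V -> W1) (g : V -> W2) : open U ->
  Ck_on k U f -> Ck_on k U g -> Ck_on k U (fun x => (f x, g x)).
Proof.
move=> oU; elim: k f g => [|k IH] f g.
  by move=> cf cg x Ux; exact: (cvg_pair (cf x Ux) (cg x Ux)).
move=> ckf ckg; apply: (@Ck_onS _ _ _ _ _ (fun x v => ('d f x v, 'd g x v))) => //.
  by move=> x Ux; apply: is_diff_pair; [exact: Ck_on_diff ckf Ux|exact: Ck_on_diff ckg
    Ux].
by move=> v; apply: IH; exact: Ck_on_d.
Qed.

Lemma Ck_on_scale V W k (U : set V) (f : V -> R) (g : V -> W) : open U ->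
  Ck_on k U f -> Ck_on k U g -> Ck_on k U (fun x => f x *: g x).
Proof.
move=> oU; elim: k f g => [|k IH] f g.
  by move=> cf cg x Ux; exact: (cvgZ (cf x Ux) (cg x Ux)).
move=> ckf ckg.
apply: (@Ck_onS _ _ _ _ _ (fun x v => f x *: 'd g x v + 'd f x v *: g x)) => //.
  move=> x Ux; exact: (is_diff_scale (Ck_on_diff ckf Ux) (Ck_on_diff ckg Ux)).
move=> v; apply: Ck_on_add => //; apply: IH;
  by [exact: Ck_onW|exact: Ck_on_d].
Qed.

(** It precedes the general composition, which applies it to coordinate functionals. The derivative
    of the outer map is constant here, so a direction that varies with the point causes no
    trouble. *)
Lemma Ck_on_lin_comp V W1 W2 k (U : set V) (f : V -> W1) (g : {linear W1 -> W2}) :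
  open U -> continuous g -> Ck_on k U f -> Ck_on k U (g \o f).
Proof.
move=> oU cg; elim: k f => [|k IH] f.
  by move=> cf x Ux; apply: continuous_comp; [exact: cf|exact: cg].
move=> ckf; apply: (@Ck_onS _ _ _ _ _ (fun x v => g ('d f x v))) => //.
  move=> x Ux; exact: (is_diff_comp (Ck_on_diff ckf Ux) (is_diff_lin _ cg)).
by move=> v; apply: IH; exact: Ck_on_d.
Qed.

Lemma Ck_on_sum V W k (U : set V) (I : Type) (r : seq I) (f : I -> V -> W) :
  open U -> (forall i, Ck_on k U (f i)) ->
  Ck_on k U (fun x => \sum_(i <- r) f i x).
Proof.
move=> oU ckf; elim: r => [|i r IH].
  by apply: eq_Ck_on (Ck_on_cst _ _ 0) => // x _; rewrite big_nil.
by apply: eq_Ck_on (Ck_on_add oU (ckf i) IH) => // x _; rewrite big_cons.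
Qed.

(** A spanning family with continuous coordinates, a form that passes to products at once. It serves
    to expand directions that vary with the point, whereas [Ck_on] only speaks of fixed
    directions. *)
Definition finite_dim V : Prop :=
  exists (I : finType) (e : I -> V) (c : I -> {linear V -> R}),
    (forall i, continuous (c i)) /\ forall v, v = \sum_i c i v *: e i.
Existing Class finite_dim.

(** The chain rule applies the differential of [g] to the moving direction ['d f x v]. Expanding
    that direction in the spanning family leaves products of scalar functions with derivatives of
    [g] in fixed directions, to which the induction hypothesis applies. *)
Lemma Ck_on_comp V W1 W2 {fd : finite_dim W1} k (U : set V) (Z : set W1)
    (f : V -> W1) (g : W1 -> W2) : open U -> (forall x, U x -> Z (f x)) ->
  Ck_on k U f -> Ck_on k Z g -> Ck_on k U (g \o f).
Proof.
case: fd => I [e [c [cc ce]]] oU UZ; elim: k g => [|k IH] g.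
  move=> cf cg x Ux; apply: continuous_comp; [exact: cf|exact/cg/UZ].
move=> ckf ckg.
apply: (@Ck_onS _ _ _ _ _
    (fun x v => \sum_i c i ('d f x v) *: 'd g (f x) (e i))) => //.
  move=> x Ux.
  have /is_diff_eq := is_diff_comp (Ck_on_diff ckf Ux) (Ck_on_diff ckg (UZ x Ux)).
  apply; apply/funext => v /=.
  by rewrite [in LHS](ce ('d f x v)) linear_sum; apply: eq_bigr => i _; rewrite linearZ.
move=> v; apply: Ck_on_sum => // i; apply: Ck_on_scale => //.
  by apply: (Ck_on_lin_comp (g := c i)) => //; exact: Ck_on_d.
by apply: (IH (fun y => 'd g y (e i))); [exact: Ck_onW|exact: Ck_on_d].
Qed.

End CkTheory.

(** * Germs of smooth maps between normed spaces *)

Section SmoothNear.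
Variable R : realType.
Implicit Types V W : normedModType R.

#[global] Instance finite_dim_real : finite_dim R.
Proof.
exists unit, (fun=> 1), (fun=> (idfun : {linear R -> R})); split.
  by move=> _ x; exact: cvg_id.
move=> v; rewrite big_const card_unit /= addr0.
exact/esym/mulr1.
Qed.

Lemma coord_linear m n (i : 'I_m) (j : 'I_n) :
  linear (fun M : 'M[R]_(m, n) => M i j).
Proof. by move=> a M N; rewrite !mxE. Qed.

Definition coord_lin m n (i : 'I_m) (j : 'I_n) : {linear 'M[R]_(m, n) -> R} :=
  HB.pack (fun M : 'M[R]_(m, n) => M i j)
    (GRing.isLinear.Build _ _ _ _ _ (coord_linear i j)).

#[global] Instance finite_dim_matrix m n : finite_dim 'M[R]_(m, n).
Proof.
exists ('I_m * 'I_n)%type, (fun ij => delta_mx ij.1 ij.2),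
  (fun ij => coord_lin ij.1 ij.2); split.
  by move=> ij; exact: coord_continuous.
move=> M; rewrite [LHS]matrix_sum_delta.
by rewrite (pair_bigA _ (fun i j => M i j *: delta_mx i j)).
Qed.

#[global] Instance finite_dim_prod V W : finite_dim V -> finite_dim W -> finite_dim
  (V * W)%type.
Proof.
move=> [I [e [c [cc ce]]]] [J [d [b [cb be]]]].
pose k (ij : (I + J)%type) : {linear (V * W)%type -> R} :=
  match ij with inl i => c i \o fst | inr j => b j \o snd end.
pose h (ij : (I + J)%type) : (V * W)%type :=
  match ij with inl i => (e i, 0) | inr j => (0, d j) end.
exists (I + J)%type, h, k; split.
  by case=> [i|j] x /=; apply: continuous_comp;
    [exact: cvg_fst|exact: cc|exact: cvg_snd|exact: cb].
move=> [v w]; rewrite big_sumType /= {1}(ce v) {1}(be w).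
apply: (@injective_projections _ _); rewrite /= !raddf_sum /=.
  rewrite [X in _ + X]big1 ?addr0 => [|j _]; last by rewrite scaler0.
  by [].
by rewrite [X in X + _]big1 ?add0r => [|j _]; last rewrite scaler0.
Qed.

(** The neighbourhood is chosen before the order of differentiability. Hence smoothness passes to
    nearby points and to directional derivatives without shrinking anything. *)
Definition smooth_near V W (f : V -> W) (x : V) : Prop :=
  exists2 U, open_nbhs x U & Cinfty_on U f.

Lemma smooth_near_diff V W (f : V -> W) x : smooth_near f x -> is_diff x f ('d f x).
Proof. by case=> U [oU Ux] /(_ 1%N)/Ck_on_diff; exact. Qed.

Lemma smooth_near_near V W (f : V -> W) x :
  smooth_near f x -> \forall y \near x, smooth_near f y.
Proof.
case=> U [oU Ux] cf; apply: filterS (open_nbhs_nbhs (conj oU Ux)) => y Uy.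
by exists U.
Qed.

Lemma smooth_near_cont V W (f : V -> W) x : smooth_near f x -> {for x, continuous f}.
Proof. by case=> U [oU Ux] /(_ 0%N); exact. Qed.

Lemma smooth_near_d V W (f : V -> W) x v :
  smooth_near f x -> smooth_near (fun y => 'd f y v) x.
Proof. by case=> U oU cf; exists U => // k; exact: Ck_on_d (cf k.+1). Qed.

Lemma near_eq_smooth V W (f g : V -> W) x :
  {near x, f =1 g} -> smooth_near f x -> smooth_near g x.
Proof.
rewrite /prop_near1 nbhsE => -[Z [oZ Zx] fg] [U [oU Ux] cf].
exists (U `&` Z); first by split; [exact: openI|].
move=> k; apply: (@eq_Ck_on _ _ _ _ _ f); first exact: openI.
  by move=> y [_ /fg].
by apply: Ck_on_subset (cf k) => y [].
Qed.

Lemma smooth_near_cst V W (w : W) (x : V) : smooth_near (cst w) x.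
Proof. by exists setT => [|k]; [split; [exact: openT|]|exact: Ck_on_cst]. Qed.

Lemma smooth_near_lin V W (f : {linear V -> W}) x :
  continuous f -> smooth_near f x.
Proof. by exists setT => [|k]; [split; [exact: openT|]|exact: Ck_on_lin]. Qed.

Lemma smooth_near_id V (x : V) : smooth_near (id : V -> V) x.
Proof. by apply: (smooth_near_lin (f := idfun)) => y; exact: cvg_id. Qed.

Lemma smooth_near_fst V W (x : V * W) : smooth_near (fst : V * W -> V) x.
Proof. by apply: (smooth_near_lin (f := fst)) => y; exact: cvg_fst. Qed.

Lemma smooth_near_snd V W (x : V * W) : smooth_near (snd : V * W -> W) x.
Proof. by apply: (smooth_near_lin (f := snd)) => y; exact: cvg_snd. Qed.

Lemma smooth_near_comp V W1 W2 {fd : finite_dim W1} (f : V -> W1) (g : W1 -> W2) x :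
  smooth_near f x -> smooth_near g (f x) -> smooth_near (g \o f) x.
Proof.
move=> [U [oU Ux] cf] [Z [oZ Zx] cg].
have oUZ : open (U `&` f @^-1` Z).
  rewrite openE => y [Uy Zy]; apply: filterI; first exact: open_nbhs_nbhs.
  by apply: (cf 0%N y Uy); exact: open_nbhs_nbhs.
exists (U `&` f @^-1` Z) => [|k]; first by split.
apply: (@Ck_on_comp _ _ _ _ _ _ _ Z) => //; first by move=> y [].
by apply: Ck_on_subset (cf k) => y [].
Qed.

Lemma smooth_near_fst_comp V W1 W2 (f : V -> W1 * W2) x :
  smooth_near f x -> smooth_near (fun y => (f y).1) x.
Proof.
case=> U oU cf; exists U => // k.
by apply: (Ck_on_lin_comp (g := fst) oU.1) => // y; exact: cvg_fst.
Qed.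

Lemma smooth_near_snd_comp V W1 W2 (f : V -> W1 * W2) x :
  smooth_near f x -> smooth_near (fun y => (f y).2) x.
Proof.
case=> U oU cf; exists U => // k.
by apply: (Ck_on_lin_comp (g := snd) oU.1) => // y; exact: cvg_snd.
Qed.

Section Algebra.
Variables (V W : normedModType R) (x : V).

Let smooth_nearI W1 W2 W3 (f : V -> W1) (g : V -> W2) (h : V -> W3) :
  (forall k U, open U -> Ck_on k U f -> Ck_on k U g -> Ck_on k U h) ->
  smooth_near f x -> smooth_near g x -> smooth_near h x.
Proof.
move=> H [U [oU Ux] cf] [Z [oZ Zx] cg].
exists (U `&` Z); first by split; [exact: openI|].
move=> k; apply: H; first exact: openI.
  by apply: Ck_on_subset (cf k) => y [].
by apply: Ck_on_subset (cg k) => y [].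
Qed.

Lemma smooth_near_add (f g : V -> W) :
  smooth_near f x -> smooth_near g x -> smooth_near (fun y => f y + g y) x.
Proof. by apply: smooth_nearI => k U; exact: Ck_on_add. Qed.

Lemma smooth_near_opp (f : V -> W) :
  smooth_near f x -> smooth_near (fun y => - f y) x.
Proof.
case=> U oU cf; exists U => // k.
by apply: (Ck_on_lin_comp (g := -%R) oU.1) => // y; exact: opp_continuous.
Qed.

Lemma smooth_near_sub (f g : V -> W) :
  smooth_near f x -> smooth_near g x -> smooth_near (fun y => f y - g y) x.
Proof. by move=> sf sg; apply: smooth_near_add => //; exact: smooth_near_opp. Qed.

Lemma smooth_near_pair W2 (f : V -> W) (g : V -> W2) :
  smooth_near f x -> smooth_near g x -> smooth_near (fun y => (f y, g y)) x.
Proof. by apply: smooth_nearI => k U; exact: Ck_on_pair. Qed.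

Lemma smooth_near_scale (f : V -> R) (g : V -> W) :
  smooth_near f x -> smooth_near g x -> smooth_near (fun y => f y *: g y) x.
Proof. by apply: smooth_nearI => k U; exact: Ck_on_scale. Qed.

Lemma smooth_near_sum (I : Type) (r : seq I) (f : I -> V -> W) :
  (forall i, smooth_near (f i) x) -> smooth_near (fun y => \sum_(i <- r) f i y) x.
Proof.
move=> sf; elim: r => [|i r IH].
  by under eq_fun do rewrite big_nil; exact: smooth_near_cst.
by under eq_fun do rewrite big_cons; exact: smooth_near_add.
Qed.

End Algebra.

Lemma smooth_near_coord V m n (f : V -> 'M[R]_(m, n)) x i j :
  smooth_near f x -> smooth_near (fun y => f y i j) x.
Proof.
move=> sf; apply: (smooth_near_comp (g := coord_lin i j) sf).
by apply: (smooth_near_lin (f := coord_lin i j)); exact: coord_continuous.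
Qed.

Lemma is_diff_coord V m n (f df : V -> 'M[R]_(m, n)) x i j :
  is_diff x f df -> is_diff x (fun y => f y i j) (fun v => df v i j).
Proof.
move=> dfx; apply: (is_diff_comp dfx (is_diff_lin (f := coord_lin i j) (f x) _)).
exact: coord_continuous.
Qed.

Lemma smooth_near_mx V m n (f : V -> 'M[R]_(m, n)) x :
  (forall i j, smooth_near (fun y => f y i j) x) -> smooth_near f x.
Proof.
move=> sf; apply: (@near_eq_smooth _ _
    (fun y => \sum_i \sum_j f y i j *: delta_mx i j)).
  by apply: filterE => y; rewrite -matrix_sum_delta.
apply: smooth_near_sum => i; apply: smooth_near_sum => j.
by apply: smooth_near_scale => //; exact: smooth_near_cst.
Qed.

Lemma smooth_near_trmx (V : normedModType R) m k (f : V -> 'M[R]_(m, k)) x :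
  smooth_near f x -> smooth_near (fun y => (f y)^T) x.
Proof.
move=> sf; apply: smooth_near_mx => i j.
apply: near_eq_smooth (smooth_near_coord j i sf).
by apply: filterE => y; rewrite mxE.
Qed.

End SmoothNear.

(** * Smooth maps in preferred charts *)

Section Charts.
Variable R : realType.
Implicit Types V W : normedModType R.

(** These properties of preferred charts, mostly around the base point, hold for manifolds and for
    identity charts and are inherited by products, so one chain rule covers G, the line and
    TT^*G. *)
Record charts_ok (T : topologicalType) V (C : charted T V) : Prop := ChartsOk {
  ok_dom : forall x, nbhs x (chart_dom C x);
  ok_K : forall x y, chart_dom C x y -> chart_inv C x (chart C x y) = y;
  ok_cont : forall x, {for x, continuous (chart C x)};
  ok_inv_cont : forall x, {for chart C x x, continuous (chart_inv C x)};
  ok_invK : forall x, {near chart C x x, cancel (chart_inv C x) (chart C x)} }.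
Arguments ok_dom {T V C} _ x.
Arguments ok_invK {T V C} _ x.

Lemma manifold_charts_ok (T : topologicalType) V (C : charted T V) :
  is_manifold C -> charts_ok C.
Proof.
move=> M; have memx := chart_dom_mem M.
split.
- by move=> x; apply: open_nbhs_nbhs; split; [exact: chart_dom_open M x|].
- exact: chartK M.
- by move=> x; exact: (chart_continuous M).
- by move=> x; apply: (chart_inv_continuous M); exists x.
- move=> x; have : nbhs (chart C x x) (chart C x @` chart_dom C x).
    by apply: open_nbhs_nbhs; split; [exact: chart_image_open M x|exists x].
  by apply: filterS => _ [y xy <-]; rewrite (chartK M).
Qed.

Lemma id_charts_ok V : charts_ok (id_charted V).
Proof.
split=> //=; [by move=> x; exact: filterT| | |].
- by move=> x; exact: cvg_id.
- by move=> x; exact: cvg_id.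
- by move=> x; exact: filterE.
Qed.

Lemma prod_charts_ok (T1 T2 : topologicalType) V1 V2 (C1 : charted T1 V1)
    (C2 : charted T2 V2) :
  charts_ok C1 -> charts_ok C2 -> charts_ok (prod_charted C1 C2).
Proof.
move=> ok1 ok2; split=> /=.
- move=> [x1 x2] /=; exists (chart_dom C1 x1, chart_dom C2 x2) => //=.
  by split; exact: ok_dom.
- by move=> [x1 x2] [y1 y2] /= [xy1 xy2]; rewrite !ok_K.
- move=> [x1 x2] /=; apply: cvg_pair.
    by apply: cvg_comp; [exact: cvg_fst|exact: ok_cont].
  by apply: cvg_comp; [exact: cvg_snd|exact: ok_cont].
- move=> [x1 x2] /=; apply: cvg_pair.
    by apply: cvg_comp; [exact: cvg_fst|exact: (ok_inv_cont ok1)].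
  by apply: cvg_comp; [exact: cvg_snd|exact: (ok_inv_cont ok2)].
- move=> [x1 x2] /=.
  exists ([set u | chart C1 x1 (chart_inv C1 x1 u) = u],
          [set u | chart C2 x2 (chart_inv C2 x2 u) = u]) => /=.
    by split; exact: ok_invK.
  by move=> [u1 u2] /= [-> ->].
Qed.

Section Maps.
Variables (T1 T2 T3 : topologicalType) (V1 V2 V3 : normedModType R).
Variables (C1 : charted T1 V1) (C2 : charted T2 V2) (C3 : charted T3 V3).
Hypotheses (ok1 : charts_ok C1) (ok2 : charts_ok C2).

Lemma ok_inv_base x : chart_inv C1 x (chart C1 x x) = x.
Proof. by apply: ok_K => //; exact: nbhs_singleton (ok_dom ok1 x). Qed.

Lemma in_charts_base (f : T1 -> T2) x :
  in_charts C1 C2 f x (chart C1 x x) = chart C2 (f x) (f x).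
Proof. by rewrite /in_charts /= ok_inv_base. Qed.

Lemma smooth_at_in_charts (f : T1 -> T2) x : smooth_at C1 C2 f x ->
  smooth_near (in_charts C1 C2 f x) (chart C1 x x).
Proof. by case. Qed.

Lemma cvg_chart_inv x : chart_inv C1 x u @[u --> chart C1 x x] --> x.
Proof.
by have := ok_inv_cont ok1 (x := x); rewrite /prop_for /continuous_at ok_inv_base.
Qed.

(* The preferred charts at [x], [f x] and [g (f x)] match, so that no chart
   transition is involved. *)
Lemma in_charts_comp (f : T1 -> T2) (g : T2 -> T3) x :
  {for x, continuous f} ->
  {near chart C1 x x, in_charts C2 C3 g (f x) \o in_charts C1 C2 f x
    =1 in_charts C1 C3 (g \o f) x}.
Proof.
move=> cf; have : \forall u \near chart C1 x x, chart_dom C2 (f x) (f (chart_inv C1 x u)).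
  by have := cvg_comp _ _ (@cvg_chart_inv x) cf _ (ok_dom ok2 (f x)).
by apply: filterS => u fu; rewrite /in_charts /= ok_K.
Qed.

Lemma smooth_at_comp {fd : finite_dim V2} (f : T1 -> T2) (g : T2 -> T3) x :
  smooth_at C1 C2 f x -> smooth_at C2 C3 g (f x) -> smooth_at C1 C3 (g \o f) x.
Proof.
move=> sf sg; split; first by apply: continuous_comp; [case: sf|case: sg].
apply: near_eq_smooth (in_charts_comp _ _) _; first by case: sf.
apply: smooth_near_comp; first exact: smooth_at_in_charts.
by rewrite in_charts_base; exact: (sg.2).
Qed.

Lemma tangent_comp (f : T1 -> T2) (g : T2 -> T3) x v :
  smooth_at C1 C2 f x -> smooth_at C2 C3 g (f x) ->
  tangent C1 C3 (g \o f) x v = tangent C2 C3 g (f x) (tangent C1 C2 f x v).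
Proof.
move=> sf sg; have df := smooth_near_diff (smooth_at_in_charts sf).
have dg : is_diff (in_charts C1 C2 f x (chart C1 x x)) (in_charts C2 C3 g (f x))
    ('d (in_charts C2 C3 g (f x)) (chart C2 (f x) (f x))).
  by rewrite in_charts_base; exact: smooth_near_diff sg.2.
have [dgf dgfE] := is_diffP (is_diff_comp df dg).
have [_] := is_diffP (near_eq_is_diff (in_charts_comp g sf.1) dgf).
by rewrite /tangent => ->; rewrite dgfE.
Qed.

Lemma smooth_at_pair (f : T1 -> T2) (g : T1 -> T3) x :
  smooth_at C1 C2 f x -> smooth_at C1 C3 g x ->
  smooth_at C1 (prod_charted C2 C3) (fun y => (f y, g y)) x.
Proof.
move=> sf sg; split; first by apply: cvg_pair; [exact: sf.1|exact: sg.1].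
exact: (smooth_near_pair sf.2 sg.2).
Qed.

Lemma smooth_at_cst (y : T2) x : smooth_at C1 C2 (cst y) x.
Proof.
split; first exact: cvg_cst.
exact: (smooth_near_cst (chart C2 y y) (chart C1 x x)).
Qed.

(** The inverse chart sends the base point to [x], so its target is read in the very chart being
    inverted and the map becomes the identity near that point. *)
Lemma smooth_at_chart_inv x :
  smooth_at (id_charted V1) C1 (chart_inv C1 x) (chart C1 x x).
Proof.
split; first exact: ok_inv_cont.
apply: (@near_eq_smooth _ _ _ id); last exact: smooth_near_id.
have := ok_invK ok1 x; apply: filterS => u ux.
by rewrite /in_charts /= ok_inv_base ux.
Qed.

Lemma tangent_chart_inv x v :
  tangent (id_charted V1) C1 (chart_inv C1 x) (chart C1 x x) v = v.
Proof.
have H : {near chart C1 x x, id =1 in_charts (id_charted V1) C1 (chart_inv C1 x)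
  (chart C1 x x)}.
  have := ok_invK ok1 x; apply: filterS => u ux.
  by rewrite /in_charts /= ok_inv_base ux.
have did := is_diff_id (chart C1 x x).
have [_] := is_diffP (near_eq_is_diff H (is_diffP did).1).
by rewrite /tangent => ->; rewrite diff_val.
Qed.

Lemma smooth_at_chart x : smooth_at C1 (id_charted V1) (chart C1 x) x.
Proof.
split; first exact: ok_cont.
apply: (@near_eq_smooth _ _ _ id); last exact: smooth_near_id.
by have := ok_invK ok1 x; apply: filterS.
Qed.

Lemma tangent_chart x v : tangent C1 (id_charted V1) (chart C1 x) x v = v.
Proof.
have H : {near chart C1 x x, id =1 in_charts C1 (id_charted V1) (chart C1 x) x}.
  by have := ok_invK ok1 x; apply: filterS => u ux; rewrite /in_charts /= ux.
have did := is_diff_id (chart C1 x x).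
have [_] := is_diffP (near_eq_is_diff H (is_diffP did).1).
by rewrite /tangent => ->; rewrite diff_val.
Qed.

End Maps.

Lemma smooth_at_near V W (f : V -> W) x :
  smooth_at (id_charted V) (id_charted W) f x <-> smooth_near f x.
Proof. by split=> [[]//|sf]; split=> //; exact: smooth_near_cont. Qed.

End Charts.

(** * Mixed derivatives *)

Section Slices.
Variable R : realType.
Implicit Types V W : normedModType R.

Lemma is_diff_is_derive V W (f df : V -> W) x v :
  is_diff x f df -> is_derive x v f (df v).
Proof.
move=> dfx; have [d E] := is_diffP dfx.
by apply: DeriveDef; [exact: diff_derivable|rewrite deriveE].
Qed.

Lemma is_diff_is_derive1 W (f df : R -> W) (t : R) :
  is_diff t f df -> is_derive t 1 f (df 1).
Proof. exact: is_diff_is_derive. Qed.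

Lemma is_derive_diff W (f : R -> W) (t : R) (w : W) :
  is_derive t 1 f w -> is_diff t f (fun s => s *: w).
Proof.
move=> dfx; apply: DiffDef; first by apply/derivable1_diffP; exact: ex_derive.
by rewrite deriv1E; [rewrite derive1E derive_val|exact: ex_derive].
Qed.

Lemma is_diff_slice1 V1 V2 W (f df : V1 * V2 -> W) (x : V1) (y : V2) :
  is_diff (x, y) f df -> is_diff x (fun x => f (x, y)) (fun v => df (v, 0)).
Proof.
move=> dfx; exact: (is_diff_comp (is_diff_pair (is_diff_id x) (is_diff_cst y x)) dfx).
Qed.

Lemma is_diff_slice2 V1 V2 W (f df : V1 * V2 -> W) (x : V1) (y : V2) :
  is_diff (x, y) f df -> is_diff y (fun y => f (x, y)) (fun v => df (0, v)).
Proof.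
move=> dfx; exact: (is_diff_comp (is_diff_pair (is_diff_cst x y) (is_diff_id y)) dfx).
Qed.

Lemma MVT_local (f df : R -> R) (s : R) : 0 < s ->
  (forall x, 0 <= x <= s -> is_derive x 1 f (df x)) ->
  exists2 c, 0 < c < s & f s - f 0 = df c * s.
Proof.
move=> s0 dfP; have [|//||c] := @MVT R f df 0 s.
- by [].
- by move=> x /[!in_itv]/= /andP[/ltW ? /ltW ?]; apply: dfP; apply/andP.
- apply: derivable_within_continuous => x /[!in_itv]/= xs.
  by have := dfP _ xs => h; exact: ex_derive.
- by rewrite in_itv /= subr0 => cs E; exists c.
Qed.

(* The mean value theorem, applied twice, gives points close to 0 at which the
   iterated derivative vanishes; continuity suffices, symmetry is not needed. *)
Lemma mixed_derivative_diag0 (f : R * R -> R) (c k : R) :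
  smooth_near f 0 ->
  (\forall s \near (0 : R), f (s, 0) = c) ->
  (\forall s \near (0 : R), f (s, s) = c + s * k) ->
  (\forall r \near (0 : R), f (0, r) = c + r * k) ->
  'd (fun p => 'd f p (0, 1)) 0 (1, 0) = 0.
Proof.
(* If the iterated derivative were nonzero at the origin, it would stay nonzero on a neighbourhood;
   the mean value theorem produces a zero there. *)
move=> sf f1 f2 f3; apply/eqP/negP => /negP k2.
pose D (p : R * R) : R := 'd f p (0, 1).
have sD : smooth_near D 0 by exact: smooth_near_d.
have sDD : smooth_near (fun p => 'd D p (1, 0)) 0 by exact: smooth_near_d.
have H0 : \forall p \near (0 : R * R),
    [/\ smooth_near f p, smooth_near D p & 'd D p (1, 0) != 0].
  have Dn0 : \forall p \near (0 : R * R), 'd D p (1, 0) != 0.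
    have cD : 'd D p (1, 0) @[p --> (0 : R * R)] --> ('d D 0 (1, 0) : R).
      exact: smooth_near_cont sDD.
    by apply: (cvgr_neq0 _ cD).
  have H1 := smooth_near_near sf; have H2 := smooth_near_near sD.
  by near=> p; split; near: p.
have F3 : \forall r \near (0 : R), D (0, r) = k.
  have H1 : \forall r \near (0 : R), smooth_near f (0, r).
    have cv : (0 : R, r) @[r --> (0 : R)] --> (0 : R, 0 : R).
      exact: (smooth_near_cont (smooth_near_pair (smooth_near_cst (0 : R) (0 : R))
        (smooth_near_id (0 : R)))).
    exact: cv _ (smooth_near_near sf).
  (* To differentiate in r at a point (0, r) off the origin, the affine formula must hold on a
     neighbourhood of r. *)
  have f3' := near_join f3.
  near=> r.
  have sfr : smooth_near f (0, r) by near: r.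
  have := is_diff_is_derive1 (is_diff_slice2 (smooth_near_diff sfr)).
  have fE : \forall s \near r, c + s * k = f (0, s).
    by near: r; apply: filterS f3' => r; apply: filterS => s ->.
  have d2 : is_derive r 1 (fun s => c + s * k) k.
    have ds := is_diff_scale (is_diff_id r) (is_diff_cst k r).
    have dcs := is_diff_is_derive1 (is_diffD (is_diff_cst c r) ds).
    by apply: (is_derive_eq dcs); rewrite !fctE/= scaler0 !add0r scale1r.
  case: (near_eq_is_derive fE d2) => _ <- -[_ ->].
  by [].
have [d /= d0 dP] : exists2 d : R, 0 < d & forall s r, `|s| < d -> `|r| < d ->
  [/\ smooth_near f (s, r), smooth_near D (s, r) & 'd D (s, r) (1, 0) != 0].
  case: H0 => -[A B] /= [A0 B0] AB.
  have /nbhs_ballP[d1 /= d10 dA] := A0; have /nbhs_ballP[d2 /= d20 dB] := B0.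
  exists (Num.min d1 d2); first by rewrite lt_min d10.
  move=> s r; rewrite !lt_min => /andP[s1 _] /andP[_ r2]; apply: (AB (s, r)).
  by split; [apply: dA|apply: dB]; rewrite -ball_normE /= sub0r normrN.
have /nbhs_ballP[d3 /= d30 dF] := F3.
near (0 : R)^'+ => s.
have s0 : 0 < s by [].
have sd : s < d by near: s; exact: nbhs_right_lt.
have sd3 : s < d3 by near: s; exact: nbhs_right_lt.
have fs0 : f (s, 0) = c by near: s; exact: cvg_within f1.
have fss : f (s, s) = c + s * k by near: s; exact: cvg_within f2.
have dP' x y : 0 <= x <= s -> 0 <= y <= s ->
  [/\ smooth_near f (x, y), smooth_near D (x, y) & 'd D (x, y) (1, 0) != 0].
  move=> /andP[x0 xs] /andP[y0 ys].
  by apply: dP; rewrite ger0_norm// (le_lt_trans _ sd).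
have ss : 0 <= s <= s by rewrite ltW /=.
(* On the vertical segment from (s, 0) to (s, s) the increment of [f] is s k, so [D (s, th)] equals
   k. *)
have [th ths E1] := @MVT_local (fun r => f (s, r)) (fun r => D (s, r)) s s0
  (fun x xs => is_diff_is_derive1 (is_diff_slice2
     (smooth_near_diff (let: And3 h _ _ := dP' s x ss xs in h)))).
have th' : 0 <= th <= s by move/andP: ths => [/ltW -> /ltW ->].
(* On the horizontal segment from (0, th) to (s, th) both end values of [D] are k, so its derivative
   vanishes at some [et]. *)
have [et ets E2] := @MVT_local (fun x => D (x, th)) (fun x => 'd D (x, th) (1, 0)) s s0
  (fun x xs => is_diff_is_derive1 (is_diff_slice1
     (smooth_near_diff (let: And3 _ h _ := dP' x th xs th' in h)))).
have et' : 0 <= et <= s by move/andP: ets => [/ltW -> /ltW ->].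
have [_ _ /negP] := dP' et th et' th'; apply.
have sn0 : s != 0 by rewrite gt_eqF.
have D0 : D (0, th) = k.
  apply: dF; rewrite -ball_normE /= sub0r normrN.
  by move/andP: ths => [th0 ths]; rewrite gtr0_norm// (lt_trans ths).
move: E1 E2; rewrite fs0 fss D0 addrC addKr mulrC => /(mulIf sn0) <-.
by rewrite subrr => /esym/eqP; rewrite mulf_eq0 (negbTE sn0) orbF.
Unshelve. all: by end_near. Qed.

Section MixedDerivative.
Variables (V W : normedModType R) (fdV : finite_dim V).

(** The second variable is differentiated first, as in the bracket: Ad is a derivative in the
    conjugated element, and it is then differentiated in the conjugating one. *)
Definition mixed_derivative (f : V * V -> W) (x y xi eta : V) : W :=
  'd (fun u => 'd f (u, y) (0, eta)) x xi.

Variables (f : V * V -> W) (x y : V).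
Hypothesis sf : smooth_near f (x, y).

Lemma smooth_near_slice_d eta : smooth_near (fun u => 'd f (u, y) (0, eta)) x.
Proof.
apply: (smooth_near_comp (f := fun u => (u, y)) (g := fun p => 'd f p (0, eta))).
  by apply: smooth_near_pair; [exact: smooth_near_id|exact: smooth_near_cst].
exact: smooth_near_d.
Qed.

Lemma near_slice_d : \forall u \near x,
  is_diff y (fun w => f (u, w)) (fun eta => 'd f (u, y) (0, eta)).
Proof.
have cv : (u, y) @[u --> x] --> (x, y).
  exact: (smooth_near_cont (smooth_near_pair (smooth_near_id x) (smooth_near_cst y x))).
have H : \forall u \near x, smooth_near f (u, y) by exact: cv _ (smooth_near_near sf).
by apply: filterS H => u su; exact: is_diff_slice2 (smooth_near_diff su).
Qed.

Lemma mixed_derivative_linearl eta : linear (mixed_derivative f x y ^~ eta).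
Proof. by move=> a u v; rewrite /mixed_derivative linearP. Qed.

Lemma mixed_derivative_linearr xi : linear (mixed_derivative f x y xi).
Proof.
move=> a u v; rewrite /mixed_derivative.
have du := smooth_near_diff (smooth_near_slice_d u).
have dv := smooth_near_diff (smooth_near_slice_d v).
have [_ duv] := is_diffP (is_diff_linear_comb a du dv).
rewrite -(duv xi); congr ('d _ _ _).
apply/funext => z.
have -> : (0 : V, a *: u + v) = a *: (0, u) + (0, v).
  by rewrite -[RHS]/(a *: 0 + 0, a *: u + v) scaler0 addr0.
exact: linearP.
Qed.

(** Stated along an arbitrary curve of velocity [xi], because a one-parameter subgroup read in a
    chart is not a straight line. *)
Lemma is_derive_mixed eta (u : R -> V) (t : R) (xi : V) : u t = x ->
  is_diff t u (fun s => s *: xi) ->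
  is_derive t 1 (fun s => 'd f (u s, y) (0, eta)) (mixed_derivative f x y xi eta).
Proof.
move=> utx du; have dpsi : is_diff (u t) (fun z => 'd f (z, y) (0, eta))
    (mixed_derivative f x y ^~ eta).
  by rewrite utx; exact: smooth_near_diff (smooth_near_slice_d eta).
have [? E] := is_diff_is_derive1 (is_diff_comp du dpsi).
by apply: DeriveDef => //; rewrite E /= scale1r.
Qed.

End MixedDerivative.

(** Moving both variables along [v] and taking one matrix entry at a time turns [f] into a function
    on the plane, where [mixed_derivative_diag0] applies. *)
Lemma mixed_derivative_alternate V m n (fdV : finite_dim V)
    (f : V * V -> 'M[R]_(m, n)) (x v : V) (c k : 'M[R]_(m, n)) :
  smooth_near f (x, x) ->
  (\forall s \near (0 : R), f (x + s *: v, x) = c) ->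
  (\forall s \near (0 : R), f (x + s *: v, x + s *: v) = c + s *: k) ->
  (\forall s \near (0 : R), f (x, x + s *: v) = c + s *: k) ->
  mixed_derivative f x x v v = 0.
Proof.
move=> sf f1 f2 f3; apply/matrixP => i j; rewrite [RHS]mxE.
pose A (p : R * R) : V * V := (x + p.1 *: v, x + p.2 *: v).
have sl (W : normedModType R) (g : W -> R) w : smooth_near g w ->
    smooth_near (fun z => x + g z *: v) w.
  move=> sg; apply: smooth_near_add; first exact: smooth_near_cst.
  by apply: smooth_near_scale => //; exact: smooth_near_cst.
have dl (W : normedModType R) (g dg : W -> R) w : is_diff w g dg ->
    is_diff w (fun z => x + g z *: v) (fun z => dg z *: v).
  move=> dg'; have := is_diffD (is_diff_cst x w) (is_diff_scale dg' (is_diff_cst v w)).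
  move=> /is_diff_eq; apply; apply/funext => z.
  by rewrite !fctE scaler0 !add0r.
have sA p : smooth_near A p.
  by apply: smooth_near_pair; apply: sl; [exact: smooth_near_fst|exact: smooth_near_snd].
have A0 : A 0 = (x, x) by rewrite /A /= scale0r addr0.
have sfA : smooth_near (f \o A) 0 by apply: smooth_near_comp; rewrite ?A0.
pose F p := f (A p) i j.
have sF : smooth_near F 0 by exact: (smooth_near_coord (f := f \o A)).
have := @mixed_derivative_diag0 F (c i j) (k i j) sF.
have F1 : \forall s \near (0 : R), F (s, 0) = c i j.
  by apply: filterS f1 => s; rewrite /F /A /= scale0r addr0 => ->.
have F2 : \forall s \near (0 : R), F (s, s) = c i j + s * k i j.
  by apply: filterS f2 => s; rewrite /F /A /= => ->; rewrite !mxE.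
have F3 : \forall s \near (0 : R), F (0, s) = c i j + s * k i j.
  by apply: filterS f3 => s; rewrite /F /A /= scale0r addr0 => ->; rewrite !mxE.
move=> /(_ F1 F2 F3) F0.
have sD : smooth_near (fun p => 'd F p (0, 1)) (0 : R, 0 : R) by exact: smooth_near_d.
have F0' : 'D_1 (fun s => 'd F (s, 0) (0, 1)) (0 : R) = 0.
  by apply: etrans F0; case: (is_diff_is_derive1 (is_diff_slice1 (smooth_near_diff sD))).
have u0 : x + (0 : R) *: v = x by rewrite scale0r addr0.
have cu : x + s *: v @[s --> (0 : R)] --> x.
  have := smooth_near_cont (sl R id 0 (smooth_near_id _)).
  by rewrite /prop_for /continuous_at u0.
have N1 : \forall s \near (0 : R), is_diff x (fun w => f (x + s *: v, w))
    (fun eta => 'd f (x + s *: v, x) (0, eta)) by exact: cu _ (near_slice_d sf).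
have N2 : \forall s \near (0 : R), smooth_near F (s, 0).
  have cv : (s, 0 : R) @[s --> (0 : R)] --> (0 : R, 0 : R).
    exact: (smooth_near_cont (smooth_near_pair (smooth_near_id (0 : R))
      (smooth_near_cst (0 : R) (0 : R)))).
  exact: cv _ (smooth_near_near sF).
(* Chain rule in the second variable alone. It identifies the inner derivatives of [F] and [f] near
   0 on the first axis, so the outer derivatives at 0 agree as well. *)
have N3 : \forall s \near (0 : R),
    'd F (s, 0) (0, 1) = 'd f (x + s *: v, x) (0, v) i j.
  near=> s.
  have d1 : is_diff x (fun w => f (x + s *: v, w))
    (fun eta => 'd f (x + s *: v, x) (0, eta)) by near: s.
  have sFs : smooth_near F (s, 0) by near: s.
  have [_ <-] := is_diffP (is_diff_slice2 (smooth_near_diff sFs)).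
  have {}d1 : is_diff (x + (0 : R) *: v) (fun w => f (x + s *: v, w))
    (fun eta => 'd f (x + s *: v, x) (0, eta)) by rewrite u0.
  have := is_diff_coord i j (is_diff_comp (dl R id id 0 (is_diff_id _)) d1).
  by move=> /is_diffP[_ ->]; rewrite /= scale1r.
have E2 := is_derive_mixed fdV sf v (u := fun s => x + s *: v) u0
  (dl R id id 0 (is_diff_id _)).
move: F0'; rewrite (near_eq_derive _ N3).
have [_ ->] := is_diff_is_derive1 (is_diff_coord i j (is_derive_diff E2)).
by rewrite scale1r.
Unshelve. all: by end_near. Qed.

End Slices.

(** * The bracket of a Lie group *)

Section LieAlgebra.
Variables (R : realType) (n : nat) (G : topGroupType) (L : lieGroup R n G).
Local Notation lie := 'rV[R]_n.
Local Notation dlie := 'cV[R]_n.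

Lemma lie_charts_ok : charts_ok L.
Proof. exact: manifold_charts_ok (lie_manifold L). Qed.
Let okL := lie_charts_ok.

Section GroupMaps.
Variables (T : topologicalType) (V : normedModType R) (C : charted T V).
Hypothesis okC : charts_ok C.

Lemma smooth_at_mul (f g : T -> G) x : smooth_at C L f x -> smooth_at C L g x ->
  smooth_at C L (fun y => (f y * g y)%g) x.
Proof.
move=> sf sg.
exact: (smooth_at_comp okC (prod_charts_ok okL okL) (smooth_at_pair sf sg)
  (lie_mul_smooth L (f x, g x))).
Qed.

Lemma smooth_at_inv (f : T -> G) x : smooth_at C L f x ->
  smooth_at C L (fun y => (f y)^-1%g) x.
Proof. by move=> sf; exact: (smooth_at_comp okC okL sf (lie_inv_smooth L (f x))). Qed.

End GroupMaps.

Local Notation e0 := (chart L 1%g 1%g).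
Local Notation gi := (chart_inv L 1%g).

Lemma chart_inv_one : chart_inv L 1%g (chart L 1%g 1%g) = 1%g.
Proof. exact: ok_inv_base. Qed.

Let gi0 : gi e0 = 1%g. Proof. exact: chart_inv_one. Qed.

Lemma smooth_at_id_G g : smooth_at L L id g.
Proof.
have ok := okL.
by split; [exact: cvg_id|exact: (smooth_at_chart ok g).2].
Qed.

Definition conj_chart (p : lie * lie) : lie :=
  chart L 1%g (chart_inv L 1%g p.1 * chart_inv L 1%g p.2 * (chart_inv L 1%g p.1)^-1)%g.

Let idV V := @id_charts_ok R V.

Lemma conj_chart_smooth : smooth_near conj_chart (e0, e0).
Proof.
apply/smooth_at_near.
have s1 : smooth_at (id_charted (lie * lie)%type) L (fun p : lie * lie => gi p.1)
  (e0, e0).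
  apply: (smooth_at_comp (f := fst) (g := gi) (idV _) (idV _)).
    by apply/smooth_at_near; exact: smooth_near_fst.
  exact: smooth_at_chart_inv.
have s2 : smooth_at (id_charted (lie * lie)%type) L (fun p : lie * lie => gi p.2)
  (e0, e0).
  apply: (smooth_at_comp (f := snd) (g := gi) (idV _) (idV _)).
    by apply/smooth_at_near; exact: smooth_near_snd.
  exact: smooth_at_chart_inv.
have s3 := smooth_at_mul (idV _) (smooth_at_mul (idV _) s1 s2) (smooth_at_inv (idV _) s1).
apply: (smooth_at_comp (g := chart L 1%g) (idV _) okL s3) => /=.
by rewrite gi0 mul1g mulgV; exact: smooth_at_chart.
Qed.

Definition ad_chart : lie -> lie -> lie := mixed_derivative conj_chart e0 e0.

(** Conjugation fixes the identity, so its source and its target are read in the same chart and Ad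
    is a partial derivative of [conj_chart]. *)
Lemma Ad_near eta : \forall u \near e0,
  Ad L (gi u) eta = 'd conj_chart (u, e0) (0, eta).
Proof.
apply: filterS (near_slice_d conj_chart_smooth) => u du.
rewrite /Ad /tangent.
have -> : in_charts L L (fun h : G => (gi u * h * (gi u)^-1)%g) 1%g =
    fun w => conj_chart (u, w).
  by apply/funext => w; rewrite /in_charts /conj_chart /= mulg1 mulgV.
by have [_ ->] := is_diffP du.
Qed.

(** The homomorphism law forces c(0) = 1. Read in the chart at the identity, the one-parameter
    subgroup has velocity [xi] at 0, so differentiating Ad along it gives the mixed derivative in
    direction [xi]. *)
Lemma ad_chartE (xi eta : lie) : is_exp L (lie_exp L) -> ad L xi eta = ad_chart xi eta.
Proof.
move=> /(_ xi); set c := fun t : R => _ => -[cD sc c'].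
have c0 : c 0 = 1%g.
  by have := cD 0 0; rewrite addr0 => /(congr1 (fun x => (c 0)^-1 * x)%g); rewrite mulKg
    mulVg.
have sc0 := sc 0.
have su : smooth_at (id_charted R) (id_charted lie) (chart L 1%g \o c) 0.
  by apply: (smooth_at_comp (idV _) okL sc0); rewrite c0; exact: smooth_at_chart.
have du : 'd (chart L 1%g \o c) 0 1 = xi.
  rewrite -[LHS]/(tangent (id_charted R) (id_charted lie) (chart L 1%g \o c) 0 (1 : R)).
  rewrite (tangent_comp (idV _) okL)//; last by rewrite c0; exact: smooth_at_chart.
  by rewrite -[tangent _ L c 0 (1 : R)]/(velocity L c 0) c' c0 tangent_chart.
(* Only for small t does c(t) lie in the domain of the chart, where the inverse chart gives it
   back. *)
have H1 : \forall t \near (0 : R), 'd conj_chart (chart L 1%g (c t), e0) (0, eta) = Ad L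
  (c t) eta.
  have cu0 : (chart L 1%g \o c) t @[t --> (0 : R)] --> e0.
    by have := su.1; rewrite /prop_for /continuous_at /= c0.
  have cc0 : c t @[t --> (0 : R)] --> (1%g : G).
    by have := sc0.1; rewrite /prop_for /continuous_at c0.
  have A1 := cu0 _ (Ad_near eta).
  have A2 := cc0 _ (ok_dom okL 1%g).
  near=> t; have /= ct : chart_dom L 1%g (c t) by near: t.
  by rewrite -[in RHS](ok_K okL ct); apply/esym; near: t.
rewrite /ad derive1E -(near_eq_derive (1 : R) H1).
have dsu : is_diff (0 : R) (chart L 1%g \o c) (fun s => s *: xi).
  have ds := smooth_near_diff su.2.
  by apply: (is_diff_eq ds); apply/funext => s; rewrite -du -linearZ /= [s *: 1]mulr1.
have u0 : (chart L 1%g \o c) 0 = e0 by rewrite /= c0.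
by have [_ ->] := is_derive_mixed _ conj_chart_smooth eta u0 dsu.
Unshelve. all: by end_near. Qed.

Lemma ad_no_exp (xi eta : lie) : ~ is_exp L (lie_exp L) -> ad L xi eta = 0.
Proof.
move=> ne; have lie_exp1 : lie_exp L = fun=> 1%g.
  by apply: xgetPN => ex /(xgetI (fun=> 1%g)).
rewrite /ad lie_exp1.
exact: derive1_cst.
Qed.

Lemma ad_chart_diag (v : lie) : ad_chart v v = 0.
Proof.
have gi_near : \forall s \near (0 : R), chart L 1%g (gi (e0 + s *: v)) = e0 + s *: v.
  have cu : e0 + s *: v @[s --> (0 : R)] --> e0.
    have := smooth_near_cont (smooth_near_add (smooth_near_cst e0 (0 : R))
      (smooth_near_scale (smooth_near_id (0 : R)) (smooth_near_cst v (0 : R)))).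
    by rewrite /prop_for /continuous_at scale0r addr0.
  exact: cu _ (ok_invK okL 1%g).
apply: (mixed_derivative_alternate _ (c := e0) (k := v) conj_chart_smooth).
- by apply: filterE => s; rewrite /conj_chart /= gi0 mulg1 mulgV.
- by apply: filterS gi_near => s; rewrite /conj_chart /= mulgK.
- by apply: filterS gi_near => s; rewrite /conj_chart /= gi0 mul1g invg1 mulg1.
Qed.

Lemma ad_linearl eta : linear (ad L ^~ eta).
Proof.
move=> a x y; have [ex|nex] := pselect (is_exp L (lie_exp L)).
  by rewrite !ad_chartE//; exact: (mixed_derivative_linearl conj_chart e0 e0 eta).
by rewrite !ad_no_exp// scaler0 addr0.
Qed.

Lemma ad_linearr xi : linear (ad L xi).
Proof.
move=> a x y; have [ex|nex] := pselect (is_exp L (lie_exp L)).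
  by rewrite !ad_chartE//; exact: (mixed_derivative_linearr _ conj_chart_smooth xi).
by rewrite !ad_no_exp// scaler0 addr0.
Qed.

Lemma ad_diag v : ad L v v = 0.
Proof.
have [ex|nex] := pselect (is_exp L (lie_exp L)).
  by rewrite ad_chartE// ad_chart_diag.
by rewrite ad_no_exp.
Qed.

Lemma ad_anti xi eta : ad L xi eta = - ad L eta xi.
Proof.
have addl u v w : ad L (u + v) w = ad L u w + ad L v w.
  by have := ad_linearl w 1 u v; rewrite !scale1r.
have addr u v w : ad L w (u + v) = ad L w u + ad L w v.
  by have := ad_linearr w 1 u v; rewrite !scale1r.
apply/eqP; rewrite -addr_eq0; apply/eqP.
by have := ad_diag (xi + eta); rewrite addl !addr !ad_diag add0r addr0.
Qed.

End LieAlgebra.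

(** * Integrals over a segment *)

Section Integrals.
Variables (R : realType) (a b : R).
Hypothesis ab : a < b.
Local Notation mu := (@lebesgue_measure R).

(** Two-sided continuity, also at [a] and [b]: smoothness at a point of the segment means smoothness
    on a full neighbourhood of it. *)
Definition cont_itv (f : R -> R) : Prop :=
  forall t, a <= t <= b -> {for t, continuous f}.

(** Covers the end points, where the weight multiplying the test variations vanishes and gives no
    information. *)
Lemma cont_itv_eq0 (q : R -> R) : cont_itv q ->
  (forall t, a < t < b -> q t = 0) -> forall t, a <= t <= b -> q t = 0.
Proof.
move=> cq q0 t /andP[at_ tb]; apply/eqP/negP => /negP qt.
have Nq : \forall s \near t, q s != 0.
  have cqt : q s @[s --> t] --> q t by apply: cq; rewrite at_.
  exact: cvgr_neq0 cqt qt.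
(* A nonzero value at t persists nearby. Interior points are found to the right of t if t < b, and
   to its left if t = b. *)
have [lt_tb|] := ltP t b.
  near t^'+ => s.
  have : q s != 0 by near: s; exact: cvg_within Nq.
  have ts : t < s by near: s; exact: nbhs_right_gt.
  have sb : s < b by near: s; exact: nbhs_right_lt.
  by rewrite q0 ?eqxx// (le_lt_trans at_ ts).
move=> bt; have at' : a < t by exact: lt_le_trans bt.
near t^'- => s.
have : q s != 0 by near: s; exact: cvg_within Nq.
have st : s < t by near: s; exact: nbhs_left_lt.
have as_ : a < s by near: s; exact: nbhs_left_gt.
by rewrite q0 ?eqxx// as_ (lt_le_trans st tb).
Unshelve. all: by end_near. Qed.

Lemma cont_itv_within f : cont_itv f -> {within `[a, b], continuous f}.
Proof.
move=> cf; apply: continuous_in_subspaceT => t /[!inE]/=.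
by rewrite in_itv /=; exact: cf.
Qed.

Lemma cont_itv_integrable f : cont_itv f -> mu.-integrable `[a, b] (EFin \o f).
Proof.
move=> cf; apply: continuous_compact_integrable; first exact: segment_compact.
exact: cont_itv_within.
Qed.

Lemma Rintegral_FTC2 (F f : R -> R) : cont_itv f ->
  (forall t, a <= t <= b -> is_derive t 1 F (f t)) ->
  \int[mu]_(t in `[a, b]) f t = F b - F a.
Proof.
move=> cf dF.
have cF t : a <= t <= b -> F x @[x --> t] --> F t.
  move=> tab; have dFt := dF t tab.
  by apply/differentiable_continuous/derivable1_diffP; exact: ex_derive.
have aab : a <= a <= b by rewrite lexx ltW.
have bab : a <= b <= b by rewrite lexx ltW.
rewrite /Rintegral (@continuous_FTC2 _ f F _ _ ab (cont_itv_within cf))//.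
  split; last 2 first.
  - exact: cvg_at_right_filter (cF a aab).
  - exact: cvg_at_left_filter (cF b bab).
  move=> t /[!in_itv]/= /andP[/ltW ta /ltW tb].
  by have dFt := dF t; apply: ex_derive; apply: dFt; rewrite ta.
move=> t /[!in_itv]/= /andP[/ltW ta /ltW tb].
have dFt : is_derive t 1 F (f t) by apply: dF; rewrite ta.
by rewrite derive1E derive_val.
Qed.

Lemma Rintegral_eq0_ge0 (f : R -> R) : cont_itv f ->
  (forall t, a <= t <= b -> 0 <= f t) ->
  \int[mu]_(t in `[a, b]) f t = 0 -> forall t, a <= t <= b -> f t = 0.
Proof.
move=> cf f0 If t0 t0ab; apply/eqP; rewrite eq_le f0// andbT leNgt.
apply/negP => ft0.
have [d /= d0 fd] : exists2 d : R, 0 < d & forall t, `|t - t0| < d -> f t0 / 2 < f t.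
  have := cf t0 t0ab; rewrite /prop_for /continuous_at => /cvgr_gt /(_ (f t0 / 2)).
  rewrite gtr_pMr// invf_lt1// ltr1n => /(_ isT) /nbhs_ballP[d /= d0 H].
  by exists d => // t td; apply: H; rewrite -ball_normE /= distrC.
(* Halving the radius keeps the closed interval inside the open ball. Clipping at [a] and [b] allows
   [t0] to be an end point while the length stays positive. *)
pose c := Num.max a (t0 - d / 2); pose e := Num.min b (t0 + d / 2).
move/andP: t0ab => [at0 t0b].
have d2 : 0 < d / 2 by rewrite divr_gt0.
have ce : c < e.
  rewrite /c /e lt_min !gt_max ab/=.
  by rewrite ltrBlDr (le_lt_trans t0b) ?ltrDl//= (le_lt_trans at0) ?ltrDl//=
    ltrBlDr -addrA ltrDl addr_gt0.
have subce : `[c, e] `<=` `[a, b].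
  move=> t /=; rewrite !in_itv /= /c /e ge_max le_min.
  by move=> /andP[/andP[-> _] /andP[-> _]].
have fce t : `[c, e]%classic t -> f t0 / 2 <= f t.
  rewrite /= in_itv /= /c /e ge_max le_min => /andP[/andP[_ h1] /andP[_ h2]].
  apply/ltW/fd; rewrite (@le_lt_trans _ _ (d / 2))//; last first.
    by rewrite gtr_pMr// invf_lt1// ltr1n.
  by rewrite ler_norml lerBrDl h1 lerBlDl h2.
have intf := cont_itv_integrable cf.
have /integrableP[mf _] := intf.
have : (\int[mu]_(t in `[c, e]) (f t0 / 2)%:E <= \int[mu]_(t in `[a, b]) (f t)%:E)%E.
  apply: (@le_trans _ _ (\int[mu]_(t in `[c, e]) (f t)%:E)%E).
    apply: ge0_le_integral => //=.
      by move=> t _; rewrite lee_fin divr_ge0// ltW.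
    exact: measurable_funS subce mf.
  have f0E t : `[a, b]%classic t -> (0 <= (EFin \o f) t)%E.
    by rewrite /= in_itv /= lee_fin; exact: f0.
  exact: (ge0_subset_integral mu _ _ mf f0E subce).
rewrite integral_cst//= lebesgue_measure_itv /= lte_fin ce -EFinD -EFinM.
have -> : (\int[mu]_(t in `[a, b]) (f t)%:E = (\int[mu]_(t in `[a, b]) f t)%:E)%E.
  by rewrite /Rintegral fineK//; exact: integrable_fin_num.
rewrite If lee_fin leNgt => /negP; apply.
by rewrite mulr_gt0 ?subr_gt0// divr_gt0.
Qed.

Lemma derive_under_Rintegral (F : R * R -> R) :
  (forall t, a <= t <= b -> smooth_near F (0, t)) ->
  is_derive (0 : R) 1 (fun eps => \int[mu]_(t in `[a, b]) F (eps, t))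
    (\int[mu]_(t in `[a, b]) 'd F (0, t) (1, 0)).
Proof.
move=> sF; pose dF (p : R * R) : R := 'd F p (1, 0).
(* The parameter is a pair: eps close to 0 and a bound close to infinity. Compactness in its
   near-covering form thus makes the window and the bound uniform in t simultaneously. *)
have : \forall p \near filter_prod (nbhs (0 : R)) +oo%R, `[a, b]%classic `<=`
    [set t | smooth_near F (p.1, t) /\ `|dF (p.1, t)| <= p.2].
  have /compact_near_coveringP/near_covering_withinP := @segment_compact R a b.
  apply=> t tab; have sFt := sF t tab.
  have cdF : {for (0, t), continuous dF} by exact: smooth_near_cont (smooth_near_d _ sFt).
  have N1 := smooth_near_near sFt.
  have N2 : \forall p \near (0, t), `|dF p| < `|dF (0, t)| + 1.
    have cn : `|dF p| @[p --> (0, t)] --> `|dF (0, t)|.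
      by apply: (cvg_comp _ _ cdF); exact: norm_continuous.
    by move/cvgr_lt : cn; apply; rewrite ltrDl.
  have [[A1 B1] /= [A10 B1t] AB1] := N1.
  have [[A2 B2] /= [A20 B2t] AB2] := N2.
  exists (B1 `&` B2, (A1 `&` A2) `*` [set M | `|dF (0, t)| + 1 <= M]) => /=.
    split; first exact: filterI.
    exists (A1 `&` A2, [set M | `|dF (0, t)| + 1 <= M]) => //=.
    by split; [exact: filterI|exact: nbhs_pinfty_ge].
  move=> [t' [x M]] /= [[B1t' B2t'] [[A1x A2x] MM]] _; split.
    exact: (AB1 (x, t') (conj A1x B1t')).
  by apply/ltW/(lt_le_trans _ MM)/(AB2 (x, t') (conj A2x B2t')).
case=> -[A B] /= [A0 B0] AB.
have /nbhs_ballP[d /= d0 dA] := A0.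
have [M BM M0] : exists2 M, B M & 0 <= M.
  have : \forall M \near +oo%R, B M /\ 0 <= M.
    by near=> M; split; near: M => //; exact: nbhs_pinfty_ge.
  by move=> /filter_ex[M [BM M0]]; exists M.
pose f (x y : R) := F (x, y).
have IA x : `]- d, d[%classic x -> A x.
  by rewrite /= in_itv /= -ltr_norml => xd; apply: dA; rewrite -ball_normE /= sub0r
    normrN.
have dFP x y : `]- d, d[%classic x -> `[a, b]%classic y ->
   smooth_near F (x, y) /\ `|dF (x, y)| <= M.
  by move=> Ix aby; exact: (AB (x, M) (conj (IA x Ix) BM) y aby).
have I0 : `]- d, d[%classic (0 : R) by rewrite /= in_itv /= oppr_lt0 d0.
have d1 x y : `]- d, d[%classic x -> `[a, b]%classic y ->
    is_derive x 1 (f ^~ y) (dF (x, y)).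
  move=> Ix aby; have [sFxy _] := dFP x y Ix aby.
  exact: is_diff_is_derive1 (is_diff_slice1 (smooth_near_diff sFxy)).
have intf x : `]- d, d[%classic x -> mu.-integrable `[a, b] (EFin \o f x).
  move=> Ix; apply: cont_itv_integrable => t tab.
  have [|sFxy _] := dFP x t Ix; first by rewrite /= in_itv.
  have [dft _] := is_diffP (is_diff_slice2 (smooth_near_diff sFxy)).
  exact: differentiable_continuous dft.
have derf x y : `]- d, d[%classic x -> `[a, b]%classic y -> derivable (f ^~ y) x 1.
  by move=> Ix aby; have := d1 x y Ix aby; case.
have G0 (y : R) : 0 <= cst M y by [].
(* The uniform bound, as a constant function, is the integrable dominating function. *)
have intG : mu.-integrable `[a, b] (EFin \o cst M).
  by apply: cont_itv_integrable => t _; exact: cvg_cst.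
have Gub x y : `]- d, d[%classic x -> `[a, b]%classic y -> `|partial1of2 f x y| <= cst M
  y.
  move=> Ix aby; have d1xy := d1 x y Ix aby.
  by rewrite partial1of2E derive_val; case: (dFP x y Ix aby).
have D1 := @derivable_under_integral R _ _ mu f _ (measurable_itv `[a, b]) _ _ _ I0 intf
  derf _ G0 intG Gub.
have D2 := @differentiation_under_integral R _ _ mu f _ (measurable_itv `[a, b]) _ _ _ I0
  intf derf _ G0 intG Gub.
apply: DeriveDef => //; rewrite -derive1E D2.
apply: eq_Rintegral => t; rewrite inE => tab.
by have d1xy := d1 0 t I0 tab; rewrite partial1of2E derive_val.
Unshelve. all: by end_near. Qed.

End Integrals.

(** * Partial derivatives and duality *)

Section Bilinear.
Variables (R : realType) (V1 V2 W : normedModType R).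
Variables (fd1 : finite_dim V1) (fd2 : finite_dim V2) (B : V1 -> V2 -> W).
Hypotheses (Bl : forall w, linear (B ^~ w)) (Br : forall v, linear (B v)).

(** Expanding both arguments in spanning families leaves finitely many constants [B (e i) (d j)].
    Continuity of [B] is thereby a consequence of finite dimension. *)
Lemma smooth_near_bilinear (V : normedModType R) (f : V -> V1) (g : V -> V2) x :
  smooth_near f x -> smooth_near g x -> smooth_near (fun y => B (f y) (g y)) x.
Proof.
move=> sf sg; case: fd1 => I [e [c [cc ce]]]; case: fd2 => J [d [k [ck kd]]].
pose Blin w : {linear V1 -> W} := HB.pack (B ^~ w) (GRing.isLinear.Build _ _ _ _ _
  (Bl w)).
pose Brin v : {linear V2 -> W} := HB.pack (B v) (GRing.isLinear.Build _ _ _ _ _ (Br v)).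
have BE v w : B v w = \sum_i \sum_j c i v *: (k j w *: B (e i) (d j)).
  rewrite {1}(ce v) -[LHS]/(Blin w _) linear_sum; apply: eq_bigr => i _.
  rewrite linearZ /= {1}(kd w) -[B (e i) _]/(Brin (e i) _) linear_sum scaler_sumr.
  by apply: eq_bigr => j _; rewrite linearZ.
apply: (@near_eq_smooth _ _ _
    (fun y => \sum_i \sum_j c i (f y) *: (k j (g y) *: B (e i) (d j)))).
  by apply: filterE => y; rewrite -BE.
apply: smooth_near_sum => i; apply: smooth_near_sum => j.
apply: smooth_near_scale.
  by apply: (smooth_near_comp (g := c i)) => //; exact: smooth_near_lin.
apply: smooth_near_scale; last exact: smooth_near_cst.
by apply: (smooth_near_comp (g := k j)) => //; exact: smooth_near_lin.
Qed.

Lemma is_diff_bilinear (V : normedModType R) (f df : V -> V1) (g dg : V -> V2) x :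
  is_diff x f df -> is_diff x g dg ->
  is_diff x (fun y => B (f y) (g y)) (fun v => B (f x) (dg v) + B (df v) (g x)).
Proof.
move=> dfx dgx.
have bil : bilinear_for
    (GRing.Scale.Law.clone _ _ *:%R _) (GRing.Scale.Law.clone _ _ *:%R _) B.
  by split=> w a u v /=; [rewrite Bl|rewrite Br].
pose bB : {bilinear V1 -> V2 -> W} :=
  HB.pack B (@bilinear_isBilinear.Build R V1 V2 W _ _ B bil).
have cB : continuous (fun p : V1 * V2 => bB p.1 p.2).
  move=> p; have sB := smooth_near_bilinear (smooth_near_fst p) (smooth_near_snd p).
  exact: smooth_near_cont sB.
have dB : is_diff (f x, g x) (fun p : V1 * V2 => bB p.1 p.2)
    (fun q => bB (f x) q.2 + bB q.1 (g x)).
  by apply: DiffDef; [exact: differentiable_bilin|exact: diff_bilin].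
exact: (is_diff_comp (is_diff_pair dfx dgx) dB).
Qed.

End Bilinear.

Section Partials.
Variable R : realType.
Implicit Types V W : normedModType R.

Lemma is_diff_fst V W1 W2 (f df : V -> W1 * W2) x : is_diff x f df ->
  is_diff x (fun y => (f y).1) (fun v => (df v).1).
Proof.
move=> dfx; apply: (is_diff_comp dfx (is_diff_lin (f := fst) (f x) _)).
by move=> y; exact: cvg_fst.
Qed.

Lemma is_diff_snd V W1 W2 (f df : V -> W1 * W2) x : is_diff x f df ->
  is_diff x (fun y => (f y).2) (fun v => (df v).2).
Proof.
move=> dfx; apply: (is_diff_comp dfx (is_diff_lin (f := snd) (f x) _)).
by move=> y; exact: cvg_snd.
Qed.

Lemma diff_proj4 V W1 W2 W3 W4 (f : V -> W1 * W2 * W3 * W4) x v :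
  differentiable f x ->
  'd f x v = ('d (fun y => (f y).1.1.1) x v, 'd (fun y => (f y).1.1.2) x v,
              'd (fun y => (f y).1.2) x v, 'd (fun y => (f y).2) x v).
Proof.
move=> /differentiableP dfx.
have d1 := is_diff_fst dfx; have d11 := is_diff_fst d1.
have [_ ->] := is_diffP (is_diff_snd dfx).
have [_ ->] := is_diffP (is_diff_snd d1).
have [_ ->] := is_diffP (is_diff_snd d11).
have [_ ->] := is_diffP (is_diff_fst d11).
by case: ('d f x v) => [[[]]].
Qed.

Lemma diff_proj4_derive W1 W2 W3 W4 (f : R -> W1 * W2 * W3 * W4) t w1 w2 w3 w4 :
  differentiable f t -> 'd (fun s => (f s).1.1.1) t 1 = w1 ->
  is_derive t 1 (fun s => (f s).1.1.2) w2 ->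
  is_derive t 1 (fun s => (f s).1.2) w3 ->
  is_derive t 1 (fun s => (f s).2) w4 -> 'd f t 1 = (w1, w2, w3, w4).
Proof.
move=> df d1 /is_derive_diff/is_diffP[_ d2] /is_derive_diff/is_diffP[_ d3].
move=> /is_derive_diff/is_diffP[_ d4].
by rewrite (diff_proj4 _ df) d1 d2 d3 d4 !scale1r.
Qed.

Section Four.
Variables (V1 V2 V3 V4 W : normedModType R) (f : V1 * V2 * V3 * V4 -> W).
Variables (x1 : V1) (x2 : V2) (x3 : V3) (x4 : V4).
Hypothesis df : differentiable f (x1, x2, x3, x4).

Let is_diff_slice (V : normedModType R) (h dh : V -> V1 * V2 * V3 * V4) y :
  h y = (x1, x2, x3, x4) -> is_diff y h dh ->
  is_diff y (f \o h) (fun v => 'd f (x1, x2, x3, x4) (dh v)).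
Proof.
move=> hy dhy; have dfh : is_diff (h y) f ('d f (x1, x2, x3, x4)).
  by rewrite hy; exact: differentiableP.
exact: is_diff_comp dhy dfh.
Qed.

Lemma is_diff_partial1 : is_diff x1 (fun y => f (y, x2, x3, x4))
  (fun v => 'd f (x1, x2, x3, x4) (v, 0, 0, 0)).
Proof.
exact: (is_diff_slice erefl (is_diff_pair (is_diff_pair (is_diff_pair
  (is_diff_id x1) (is_diff_cst x2 x1))
  (is_diff_cst x3 x1)) (is_diff_cst x4 x1))).
Qed.

Lemma is_diff_partial2 : is_diff x2 (fun y => f (x1, y, x3, x4))
  (fun v => 'd f (x1, x2, x3, x4) (0, v, 0, 0)).
Proof.
exact: (is_diff_slice erefl (is_diff_pair (is_diff_pair (is_diff_pair
  (is_diff_cst x1 x2) (is_diff_id x2))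
  (is_diff_cst x3 x2)) (is_diff_cst x4 x2))).
Qed.

Lemma is_diff_partial3 : is_diff x3 (fun y => f (x1, x2, y, x4))
  (fun v => 'd f (x1, x2, x3, x4) (0, 0, v, 0)).
Proof.
exact: (is_diff_slice erefl (is_diff_pair (is_diff_pair (is_diff_pair
  (is_diff_cst x1 x3) (is_diff_cst x2 x3))
  (is_diff_id x3)) (is_diff_cst x4 x3))).
Qed.

Lemma is_diff_partial4 : is_diff x4 (fun y => f (x1, x2, x3, y))
  (fun v => 'd f (x1, x2, x3, x4) (0, 0, 0, v)).
Proof.
exact: (is_diff_slice erefl (is_diff_pair (is_diff_pair (is_diff_pair
  (is_diff_cst x1 x4) (is_diff_cst x2 x4))
  (is_diff_cst x3 x4)) (is_diff_id x4))).
Qed.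

Lemma diff_partials v1 v2 v3 v4 : 'd f (x1, x2, x3, x4) (v1, v2, v3, v4) =
  'd (fun y => f (y, x2, x3, x4)) x1 v1 + 'd (fun y => f (x1, y, x3, x4)) x2 v2 +
  'd (fun y => f (x1, x2, y, x4)) x3 v3 + 'd (fun y => f (x1, x2, x3, y)) x4 v4.
Proof.
have [_ ->] := is_diffP is_diff_partial1.
have [_ ->] := is_diffP is_diff_partial2.
have [_ ->] := is_diffP is_diff_partial3.
have [_ ->] := is_diffP is_diff_partial4.
rewrite -!linearD; congr ('d _ _ _).
by rewrite -[RHS]/(v1 + 0 + 0 + 0, 0 + v2 + 0 + 0, 0 + 0 + v3 + 0, 0 + 0 + 0 + v4)
  !addr0 !add0r.
Qed.

End Four.

(** Turns partial derivatives at a frozen parameter into fixed-direction derivatives of the joint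
    map, which vary smoothly with the parameter. *)
Lemma diff_param4 V0 V1 V2 V3 V4 W (F : V0 * (V1 * V2 * V3 * V4) -> W) s x1 x2 x3 x4 :
  differentiable F (s, (x1, x2, x3, x4)) ->
  [/\ forall v, 'd (fun y => F (s, (y, x2, x3, x4))) x1 v =
        'd F (s, (x1, x2, x3, x4)) (0, (v, 0, 0, 0)),
      forall v, 'd (fun y => F (s, (x1, y, x3, x4))) x2 v =
        'd F (s, (x1, x2, x3, x4)) (0, (0, v, 0, 0)),
      forall v, 'd (fun y => F (s, (x1, x2, y, x4))) x3 v =
        'd F (s, (x1, x2, x3, x4)) (0, (0, 0, v, 0)) &
      forall v, 'd (fun y => F (s, (x1, x2, x3, y))) x4 v =
        'd F (s, (x1, x2, x3, x4)) (0, (0, 0, 0, v))].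
Proof.
move=> /differentiableP/is_diff_slice2/is_diffP[df dfE].
have [_ d1] := is_diffP (is_diff_partial1 df).
have [_ d2] := is_diffP (is_diff_partial2 df).
have [_ d3] := is_diffP (is_diff_partial3 df).
have [_ d4] := is_diffP (is_diff_partial4 df).
by split=> v; [rewrite d1|rewrite d2|rewrite d3|rewrite d4]; rewrite dfE.
Qed.

Lemma smooth_near_diff_along V0 V W (fd : finite_dim V) (F : V -> W) (c : V0 -> V) t h :
  smooth_near c t -> smooth_near F (c t) -> smooth_near (fun s => 'd F (c s) h) t.
Proof.
move=> sc sF.
exact: (smooth_near_comp (g := fun p => 'd F p h) sc (smooth_near_d h sF)).
Qed.

End Partials.

Section Pairing.
Variables (R : realType) (n : nat).
Implicit Types (v w : 'rV[R]_n) (alpha beta : 'cV[R]_n).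

Lemma pairing_linearl v : linear (fun alpha => pairing alpha v).
Proof. by move=> a alpha beta; rewrite /pairing mulmxDr -scalemxAr !mxE. Qed.

Lemma pairing_linearr alpha : linear (pairing alpha).
Proof. by move=> a v w; rewrite /pairing mulmxDl -scalemxAl !mxE. Qed.

Lemma pairingDl alpha beta v : pairing (alpha + beta) v = pairing alpha v + pairing beta
  v.
Proof. by have := pairing_linearl v 1 alpha beta; rewrite !scale1r. Qed.

Lemma pairingDr alpha v w : pairing alpha (v + w) = pairing alpha v + pairing alpha w.
Proof. by have := pairing_linearr alpha 1 v w; rewrite !scale1r. Qed.

Lemma pairingZl c alpha v : pairing (c *: alpha) v = c * pairing alpha v.
Proof. by rewrite /pairing -scalemxAr mxE. Qed.

Lemma pairingZr c alpha v : pairing alpha (c *: v) = c * pairing alpha v.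
Proof. by rewrite /pairing -scalemxAl mxE. Qed.

Lemma pairingNl alpha v : pairing (- alpha) v = - pairing alpha v.
Proof. by rewrite /pairing mulmxN mxE. Qed.

Lemma pairingNr alpha v : pairing alpha (- v) = - pairing alpha v.
Proof. by rewrite /pairing mulNmx mxE. Qed.

Lemma pairing0r alpha : pairing alpha 0 = 0.
Proof. by rewrite /pairing mul0mx mxE. Qed.

Lemma pairing0l v : pairing 0 v = 0.
Proof. by rewrite /pairing mulmx0 mxE. Qed.

Lemma pairing_delta alpha i : pairing alpha (delta_mx 0 i) = alpha i 0.
Proof. by rewrite /pairing -rowE mxE. Qed.

Lemma delta_pairing v i : pairing (delta_mx i 0) v = v 0 i.
Proof. by rewrite /pairing -colE mxE. Qed.

Lemma pairing_covec (L : 'rV[R]_n -> R) v : linear L -> pairing (covec L) v = L v.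
Proof.
move=> Ll; pose Lm : {linear 'rV[R]_n -> R} := HB.pack L (GRing.isLinear.Build _ _ _ _ _
  Ll).
rewrite -[RHS]/(Lm v) {2}(row_sum_delta v) linear_sum /pairing mxE.
by apply: eq_bigr => i _; rewrite mxE linearZ.
Qed.

Lemma pairing_bidual_vec (L : 'cV[R]_n -> R) alpha :
  linear L -> pairing alpha (bidual_vec L) = L alpha.
Proof.
move=> Ll; pose Lm : {linear 'cV[R]_n -> R} := HB.pack L (GRing.isLinear.Build _ _ _ _ _
  Ll).
rewrite -[RHS]/(Lm alpha) {2}(matrix_sum_delta alpha) linear_sum /pairing mxE.
apply: eq_bigr => i _; rewrite mxE big_ord1 linearZ /=.
by rewrite mulrC.
Qed.

Lemma pairing_dual_map (A : 'rV[R]_n -> 'rV[R]_n) alpha v :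
  linear A -> pairing (dual_map A alpha) v = pairing alpha (A v).
Proof.
move=> Al; apply: pairing_covec => a u w; rewrite Al.
exact: pairing_linearr.
Qed.

Lemma pairing_inj alpha beta : (forall v, pairing alpha v = pairing beta v) -> alpha =
  beta.
Proof.
by move=> ab; apply/colP => i; have := ab (delta_mx 0 i); rewrite !pairing_delta.
Qed.

(** Transposition turns a covector into a vector, and the pairing with it is a sum of squares. This
    is the positivity used when residuals serve as test variations. *)
Lemma pairing_tr_ge0 alpha : 0 <= pairing alpha alpha^T.
Proof.
by rewrite /pairing mxE; apply: sumr_ge0 => i _; rewrite mxE -expr2 sqr_ge0.
Qed.

Lemma pairing_tr_eq0 alpha : pairing alpha alpha^T = 0 -> alpha = 0.
Proof.
rewrite /pairing mxE => /eqP; rewrite psumr_eq0; last first.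
  by move=> i _; rewrite mxE -expr2 sqr_ge0.
move=> /allP h; apply/colP => i; have := h i (mem_index_enum _).
by rewrite !mxE mulf_eq0 orbb => /eqP.
Qed.

End Pairing.

(** * The Lagrangian along curves *)

Section FirstVariation.
Variables (R : realType) (n : nat) (G : topGroupType) (L : lieGroup R n G).
Local Notation lie := 'rV[R]_n.
Local Notation dlie := 'cV[R]_n.
Variables (E : TTdual R n G -> R) (hE : smooth_lagrangian L E).
Let okL := lie_charts_ok L.
Let idV V := @id_charts_ok R V.

Lemma TTdual_charts_ok : charts_ok (TTdual_charts L).
Proof.
exact: (prod_charts_ok (prod_charts_ok (prod_charts_ok okL (idV _)) (idV _)) (idV _)).
Qed.
Let okTT := TTdual_charts_ok.

Lemma finite_dim_TTdual : finite_dim (lie * dlie * lie * dlie)%type.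
Proof. exact: _. Qed.
Let fdTT := finite_dim_TTdual.

Lemma pairing_dE_dg g mu xi nu w : pairing (dE_dg L E (g, mu, xi, nu)) w =
  tangent L (id_charted R) (fun h : G => E (h, mu, xi, nu)) g w.
Proof. by apply: pairing_covec => a u v; exact: linearP. Qed.

Lemma pairing_dE_dmu g mu xi nu m : pairing m (dE_dmu E (g, mu, xi, nu)) =
  'd (fun m => E (g, m, xi, nu)) mu m.
Proof. by apply: pairing_bidual_vec => a u v; exact: linearP. Qed.

Lemma pairing_dE_dxi g mu xi nu x : pairing (dE_dxi E (g, mu, xi, nu)) x =
  'd (fun x => E (g, mu, x, nu)) xi x.
Proof. by apply: pairing_covec => a u v; exact: linearP. Qed.

Lemma pairing_dE_dnu g mu xi nu m : pairing m (dE_dnu E (g, mu, xi, nu)) =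
  'd (fun m => E (g, mu, xi, m)) nu m.
Proof. by apply: pairing_bidual_vec => a u v; exact: linearP. Qed.

Lemma tangent_lagrangian g mu xi nu w m x k :
  tangent (TTdual_charts L) (id_charted R) E (g, mu, xi, nu) (w, m, x, k) =
  pairing (dE_dg L E (g, mu, xi, nu)) w + pairing m (dE_dmu E (g, mu, xi, nu)) +
  pairing (dE_dxi E (g, mu, xi, nu)) x + pairing k (dE_dnu E (g, mu, xi, nu)).
Proof.
have [dE _] := is_diffP (smooth_near_diff (hE (g, mu, xi, nu)).2).
(* In the three linear slots, E in charts is evaluated not at g but at g sent through its chart and
   back. *)
have gK : chart_inv L g (chart L g g) = g by exact: ok_inv_base.
apply: etrans (diff_partials dE w m x k) _.
congr (_ + _ + _ + _).
- by apply: etrans (esym (pairing_dE_dg _ _ _ _ _)).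
- by apply: etrans (esym (pairing_dE_dmu _ _ _ _ _)); rewrite /in_charts /= gK.
- by apply: etrans (esym (pairing_dE_dxi _ _ _ _ _)); rewrite /in_charts /= gK.
- by apply: etrans (esym (pairing_dE_dnu _ _ _ _ _)); rewrite /in_charts /= gK.
Qed.

Lemma velocity_TTdual (c : R -> TTdual R n G) t w m x k :
  smooth_at (id_charted R) (TTdual_charts L) c t ->
  velocity L (fun s => (c s).1.1.1) t = w ->
  is_derive t 1 (fun s => (c s).1.1.2) m ->
  is_derive t 1 (fun s => (c s).1.2) x ->
  is_derive t 1 (fun s => (c s).2) k ->
  tangent (id_charted R) (TTdual_charts L) c t 1 = (w, m, x, k).
Proof.
move=> sc; have [dc _] := is_diffP (smooth_near_diff sc.2).
exact: (diff_proj4_derive dc).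
Qed.

(** The first half feeds differentiation under the integral sign and the second rewrites its
    integrand. Both come from the chain rule through TT^*G, the second along the curve eps -> X eps
    t. *)
Lemma deformation_derivative (X : R -> R -> TTdual R n G) t g mu xi nu w m x k :
  smooth_at (id_charted (R * R)%type) (TTdual_charts L)
    (fun q : R * R => X q.1 q.2) (0, t) ->
  X 0 t = (g, mu, xi, nu) ->
  velocity L (fun eps => (X eps t).1.1.1) 0 = w ->
  is_derive (0 : R) 1 (fun eps => (X eps t).1.1.2) m ->
  is_derive (0 : R) 1 (fun eps => (X eps t).1.2) x ->
  is_derive (0 : R) 1 (fun eps => (X eps t).2) k ->
  smooth_near (fun q : R * R => E (X q.1 q.2)) (0, t) /\
  'd (fun q : R * R => E (X q.1 q.2)) (0, t) (1, 0) =
    pairing (dE_dg L E (g, mu, xi, nu)) w + pairing m (dE_dmu E (g, mu, xi, nu)) +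
    pairing (dE_dxi E (g, mu, xi, nu)) x + pairing k (dE_dnu E (g, mu, xi, nu)).
Proof.
move=> sX X0 vg dmu dxi dnu.
have sF : smooth_near (fun q : R * R => E (X q.1 q.2)) (0, t).
  apply/smooth_at_near.
  exact: (smooth_at_comp (fd := fdTT) (idV _) okTT sX (hE (X 0 t))).
split=> //.
have sc : smooth_at (id_charted R) (TTdual_charts L) (X ^~ t) 0.
  apply: (smooth_at_comp (f := fun eps : R => (eps, t)) (g := fun q => X q.1 q.2)
    (idV _) (idV _) _ sX).
  apply/smooth_at_near; apply: smooth_near_pair; first exact: smooth_near_id.
  exact: smooth_near_cst.
have [_ <-] := is_diffP (is_diff_slice1 (smooth_near_diff sF)).
have T := tangent_comp (idV _) okTT (1 : R) sc (hE (X 0 t)).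
apply: etrans T _.
rewrite (velocity_TTdual sc vg dmu dxi dnu) X0.
exact: tangent_lagrangian.
Qed.

End FirstVariation.

(** * Smoothness of the trivialized partial derivatives along a curve *)

Section Trivialized.
Variables (R : realType) (n : nat) (G : topGroupType) (L : lieGroup R n G).
Local Notation lie := 'rV[R]_n.
Local Notation dlie := 'cV[R]_n.
Variables (E : TTdual R n G -> R) (hE : smooth_lagrangian L E) (g : R -> G).
Let okL := lie_charts_ok L.
Let idV V := @id_charts_ok R V.
Let okTT := TTdual_charts_ok L.
Local Notation e0 := (chart L 1%g 1%g).

(** E pulled back by right translation: the group slot is a point of the chart at the identity,
    multiplied by g(t). All four slots then lie in normed spaces independent of t. *)
Definition triv_lagrangian (q : R * (lie * dlie * lie * dlie)) : R :=
  E ((chart_inv L 1 q.2.1.1.1 * g q.1)%g, q.2.1.1.2, q.2.1.2, q.2.2).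

Lemma smooth_near_triv t m x k : smooth_at (id_charted R) L g t ->
  smooth_near triv_lagrangian (t, (e0, m, x, k)).
Proof.
move=> sg; set p := (t, (e0, m, x, k)).
have s0 := smooth_near_id p.
have s2 := smooth_near_snd_comp s0; have s21 := smooth_near_fst_comp s2.
have s211 := smooth_near_fst_comp s21.
have sgi : smooth_at (id_charted _) L
    (fun q : R * (lie * dlie * lie * dlie) => chart_inv L 1%g q.2.1.1.1) p.
  apply: (smooth_at_comp (idV _) (idV _) (f := fun q => q.2.1.1.1)).
    by apply/smooth_at_near; exact: smooth_near_fst_comp s211.
  exact: smooth_at_chart_inv.
have sg1 : smooth_at (id_charted _) L (fun q : R * (lie * dlie * lie * dlie) => g q.1) p.
  have sp1 : smooth_at (id_charted _) (id_charted R)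
      (fst : R * (lie * dlie * lie * dlie) -> R) p.
    by apply/smooth_at_near; exact: smooth_near_fst_comp s0.
  exact: (smooth_at_comp (idV _) (idV _) sp1 sg).
have sm := smooth_at_mul (idV _) sgi sg1.
have smu := iffRL (smooth_at_near _ _) (smooth_near_snd_comp s211).
have sxi := iffRL (smooth_at_near _ _) (smooth_near_snd_comp s21).
have snu := iffRL (smooth_at_near _ _) (smooth_near_snd_comp s2).
apply/smooth_at_near.
exact: (smooth_at_comp (fd := finite_dim_TTdual R n) (idV _) okTT
  (smooth_at_pair (smooth_at_pair (smooth_at_pair sm smu) sxi) snu) (hE _)).
Qed.

(** Moving the chart point off the identity moves h = g(s) through R_g, so the first partial is
    [dE_dg] composed with T_eR_g. In the other slots the chart point stays at the identity and the
    partials are those of E. *)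
Lemma triv_partials s m x k : smooth_near triv_lagrangian (s, (e0, m, x, k)) ->
  [/\ forall v, pairing (TRdual L (g s) (dE_dg L E (g s, m, x, k))) v =
        'd triv_lagrangian (s, (e0, m, x, k)) (0, (v, 0, 0, 0)),
      forall v, pairing v (dE_dmu E (g s, m, x, k)) =
        'd triv_lagrangian (s, (e0, m, x, k)) (0, (0, v, 0, 0)),
      forall v, pairing (dE_dxi E (g s, m, x, k)) v =
        'd triv_lagrangian (s, (e0, m, x, k)) (0, (0, 0, v, 0)) &
      forall v, pairing v (dE_dnu E (g s, m, x, k)) =
        'd triv_lagrangian (s, (e0, m, x, k)) (0, (0, 0, 0, v))].
Proof.
move=> st; have [dt _] := is_diffP (smooth_near_diff st).
have [d1 d2 d3 d4] := diff_param4 dt.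
have giE : (chart_inv L 1%g e0 * g s)%g = g s by rewrite chart_inv_one mul1g.
split=> v.
- apply: etrans _ (d1 v).
  rewrite /TRdual pairing_dual_map; last by move=> a u w; exact: linearP.
  rewrite pairing_dE_dg /TR.
  have sR : smooth_at L L (fun h : G => (h * g s)%g) 1%g.
    by apply: smooth_at_mul => //; [exact: smooth_at_id_G|exact: smooth_at_cst].
  have sEh h : smooth_at L (id_charted R) (fun h : G => E (h, m, x, k)) h.
    have sp := smooth_at_pair (smooth_at_pair (smooth_at_pair (smooth_at_id_G L h)
      (smooth_at_cst L (id_charted dlie) m h)) (smooth_at_cst L (id_charted lie) x h))
      (smooth_at_cst L (id_charted dlie) k h).
    exact: (smooth_at_comp (fd := finite_dim_TTdual R n) okL okTT sp (hE _)).
  have := tangent_comp okL okL v sR (sEh _).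
  by rewrite mul1g => <-.
- have e y : triv_lagrangian (s, (e0, y, x, k)) = E (g s, y, x, k)
    by rewrite /triv_lagrangian /= giE.
  have := d2 v; rewrite (funext e) => <-.
  exact: pairing_dE_dmu.
- have e y : triv_lagrangian (s, (e0, m, y, k)) = E (g s, m, y, k)
    by rewrite /triv_lagrangian /= giE.
  have := d3 v; rewrite (funext e) => <-.
  exact: pairing_dE_dxi.
- have e y : triv_lagrangian (s, (e0, m, x, y)) = E (g s, m, x, y)
    by rewrite /triv_lagrangian /= giE.
  have := d4 v; rewrite (funext e) => <-.
  exact: pairing_dE_dnu.
Qed.

Section Curve.
Variables (mu : R -> dlie) (xi : R -> lie) (nu : R -> dlie) (t : R).
Hypothesis sg : smooth_at (id_charted R) L g t.
Hypothesis smu : smooth_near mu t.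
Hypothesis sxi : smooth_near xi t.
Hypothesis snu : smooth_near nu t.

Let c s := (s, (e0, mu s, xi s, nu s)).
Let x s : TTdual R n G := (g s, mu s, xi s, nu s).

Let sc : smooth_near c t.
Proof.
apply: smooth_near_pair; first exact: smooth_near_id.
apply: smooth_near_pair => //; apply: smooth_near_pair => //.
by apply: smooth_near_pair => //; exact: smooth_near_cst.
Qed.

Let sd h : smooth_near (fun s => 'd triv_lagrangian (c s) h) t.
Proof. by apply: smooth_near_diff_along => //; exact: smooth_near_triv. Qed.

Let near_triv : \forall s \near t, smooth_near triv_lagrangian (c s).
Proof. exact: (smooth_near_cont sc) _ (smooth_near_near (smooth_near_triv _ _ _ sg)). Qed.

(** Near t each entry is the derivative of [triv_lagrangian] in one fixed direction, taken along the
    smooth curve [c]. The three lemmas that follow argue in the same way. *)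
Lemma smooth_near_TRdual_dE_dg : smooth_near (fun s => TRdual L (g s) (dE_dg L E (x s)))
  t.
Proof.
apply: smooth_near_mx => i j; rewrite (ord1 j).
apply: near_eq_smooth (sd (0, (delta_mx 0 i, 0, 0, 0))).
by apply: filterS near_triv => s /triv_partials[H _ _ _]; rewrite -pairing_delta H.
Qed.

Lemma smooth_near_dE_dmu : smooth_near (fun s => dE_dmu E (x s)) t.
Proof.
apply: smooth_near_mx => j i; rewrite (ord1 j).
apply: near_eq_smooth (sd (0, (0, delta_mx i 0, 0, 0))).
by apply: filterS near_triv => s /triv_partials[_ H _ _]; rewrite -delta_pairing H.
Qed.

Lemma smooth_near_dE_dxi : smooth_near (fun s => dE_dxi E (x s)) t.
Proof.
apply: smooth_near_mx => i j; rewrite (ord1 j).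
apply: near_eq_smooth (sd (0, (0, 0, delta_mx 0 i, 0))).
by apply: filterS near_triv => s /triv_partials[_ _ H _]; rewrite -pairing_delta H.
Qed.

Lemma smooth_near_dE_dnu : smooth_near (fun s => dE_dnu E (x s)) t.
Proof.
apply: smooth_near_mx => j i; rewrite (ord1 j).
apply: near_eq_smooth (sd (0, (0, 0, 0, delta_mx i 0))).
by apply: filterS near_triv => s /triv_partials[_ _ _ H]; rewrite -delta_pairing H.
Qed.

End Curve.

End Trivialized.

(** * First variation of the action *)

Section SmoothReal.
Variables (R : realType) (W : normedModType R).

Lemma smooth_near_derive1 (f : R -> W) t :
  smooth_near f t -> smooth_near (derive1 f) t.
Proof.
move=> sf; apply: near_eq_smooth (smooth_near_d (1 : R) sf).
apply: filterS (smooth_near_near sf) => s ss.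
by rewrite derive1E'//; exact: (is_diffP (smooth_near_diff ss)).1.
Qed.

Lemma smooth_near_is_derive (f : R -> W) t :
  smooth_near f t -> is_derive t 1 f (derive1 f t).
Proof.
move=> sf; rewrite derive1E; apply: derivableP; apply/derivable1_diffP.
exact: (is_diffP (smooth_near_diff sf)).1.
Qed.

End SmoothReal.

(* The bracket is abstract because unification would otherwise unfold [ad] and
   fail to terminate. *)
Section Cobracket.
Variables (R : realType) (n : nat).
Local Notation lie := 'rV[R]_n.
Local Notation dlie := 'cV[R]_n.
Variables (br : lie -> lie -> lie) (cobr : lie -> dlie -> dlie).
Hypothesis br_linearl : forall w, linear (br ^~ w).
Hypothesis br_anti : forall u v, br u v = - br v u.
Hypothesis pairing_cobr : forall u alpha v,
  pairing (cobr u alpha) v = - pairing alpha (br u v).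

Lemma cobracket_linearl alpha : linear (cobr ^~ alpha).
Proof.
move=> c u v; apply: pairing_inj => w.
by rewrite pairingDl pairingZl !pairing_cobr br_linearl pairingDr pairingZr opprD mulrN.
Qed.

Lemma cobracket_linearr u : linear (cobr u).
Proof.
move=> c alpha beta; apply: pairing_inj => w.
by rewrite pairingDl pairingZl !pairing_cobr pairingDl pairingZl opprD mulrN.
Qed.

(* Antisymmetry makes every term of the variation linear in [eta] alone. *)
Lemma variation_pairing (T : lie -> lie) (dg tdg dxi dxi' : dlie) (dmu dnu dnu' : lie)
    xi mu nu eta eta' lambda lambda' :
  (forall v, pairing tdg v = pairing dg (T v)) ->
  pairing dg (T eta) + pairing (lambda + cobr eta mu) dmu +
  pairing dxi (eta' + br eta xi) +
  pairing (lambda' + cobr eta nu - cobr xi lambda) dnu -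
  (pairing dxi eta' + pairing dxi' eta +
   (pairing lambda dnu' + pairing lambda' dnu)) =
  pairing (tdg - cobr dmu mu + cobr xi dxi - cobr dnu nu - dxi') eta +
  pairing lambda (dmu + br xi dnu - dnu').
Proof.
move=> TE; rewrite !(pairingDl, pairingDr, pairingNl, pairing_cobr) TE.
rewrite (br_anti eta dmu) (br_anti eta xi) (br_anti eta dnu) !pairingNr.
by ring.
Qed.

End Cobracket.

Section EulerLagrange.
Variables (R : realType) (n : nat) (G : topGroupType) (L : lieGroup R n G).
Local Notation lie := 'rV[R]_n.
Local Notation dlie := 'cV[R]_n.

Lemma pairing_coad xi mu eta : pairing (coad L xi mu) eta = - pairing mu (ad L xi eta).
Proof. by rewrite /coad pairingNl pairing_dual_map//; exact: ad_linearr. Qed.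

Lemma coad_linearl mu : linear (coad L ^~ mu).
Proof. exact: cobracket_linearl (@ad_linearl _ _ _ L) pairing_coad mu. Qed.

Lemma coad_linearr xi : linear (coad L xi).
Proof. exact: cobracket_linearr pairing_coad xi. Qed.

Section Smoothness.
Variables (V : normedModType R) (x : V).

Lemma smooth_near_ad (u v : V -> lie) : smooth_near u x -> smooth_near v x ->
  smooth_near (fun y => ad L (u y) (v y)) x.
Proof. apply: smooth_near_bilinear => w; [exact: ad_linearl|exact: ad_linearr]. Qed.

Lemma smooth_near_coad (u : V -> lie) (v : V -> dlie) :
  smooth_near u x -> smooth_near v x -> smooth_near (fun y => coad L (u y) (v y)) x.
Proof. apply: smooth_near_bilinear => w; [exact: coad_linearl|exact: coad_linearr]. Qed.

Lemma smooth_near_pairing (u : V -> dlie) (v : V -> lie) :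
  smooth_near u x -> smooth_near v x -> smooth_near (fun y => pairing (u y) (v y)) x.
Proof. apply: smooth_near_bilinear => w; [exact: pairing_linearl|exact: pairing_linearr].
  Qed.

End Smoothness.

Lemma is_derive_pairing (u : R -> dlie) (v : R -> lie) (t : R) du dv :
  is_derive t 1 u du -> is_derive t 1 v dv ->
  is_derive t 1 (fun s => pairing (u s) (v s)) (pairing (u t) dv + pairing du (v t)).
Proof.
move=> /is_derive_diff du' /is_derive_diff dv'.
have H := is_diff_bilinear (finite_dim_matrix R n 1) (finite_dim_matrix R 1 n)
  (@pairing_linearl R n) (@pairing_linearr R n) du' dv'.
by apply: is_derive_eq (is_diff_is_derive1 H) _; rewrite !scale1r.
Qed.

Variables (E : TTdual R n G -> R) (hE : smooth_lagrangian L E).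
Variables (a b : R) (ab : a < b).
Variables (g : R -> G) (mu : R -> dlie) (xi : R -> lie) (nu : R -> dlie).
Hypotheses (hg : smooth_group_curve L a b g) (hmu : smooth_curve a b mu).
Hypotheses (hxi : smooth_curve a b xi) (hnu : smooth_curve a b nu).

Local Notation x := (fun t : R => (g t, mu t, xi t, nu t) : TTdual R n G).
Local Notation mleb := (@lebesgue_measure R).

Definition el_xi t : dlie := TRdual L (g t) (dE_dg L E (x t))
  - coad L (dE_dmu E (x t)) (mu t) + coad L (xi t) (dE_dxi E (x t))
  - coad L (dE_dnu E (x t)) (nu t).
Definition el_nu t : lie := dE_dmu E (x t) + ad L (xi t) (dE_dnu E (x t)).
Definition residual_xi t : dlie := el_xi t - derive1 (fun s => dE_dxi E (x s)) t.
Definition residual_nu t : lie := el_nu t - derive1 (fun s => dE_dnu E (x s)) t.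

Let smu t : a <= t <= b -> smooth_near mu t. Proof. by move=> /hmu/smooth_at_near. Qed.
Let sxi t : a <= t <= b -> smooth_near xi t. Proof. by move=> /hxi/smooth_at_near. Qed.
Let snu t : a <= t <= b -> smooth_near nu t. Proof. by move=> /hnu/smooth_at_near. Qed.

Lemma smooth_near_dxi t : a <= t <= b -> smooth_near (fun s => dE_dxi E (x s)) t.
Proof. by move=> tab; apply: smooth_near_dE_dxi => //; auto. Qed.

Lemma smooth_near_dnu t : a <= t <= b -> smooth_near (fun s => dE_dnu E (x s)) t.
Proof. by move=> tab; apply: smooth_near_dE_dnu => //; auto. Qed.

Lemma smooth_near_residual_xi t : a <= t <= b -> smooth_near residual_xi t.
Proof.
move=> tab; have sdx := smooth_near_dxi tab; have sdn := smooth_near_dnu tab.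
have sdm : smooth_near (fun s => dE_dmu E (x s)) t.
  by apply: smooth_near_dE_dmu => //; auto.
have sdg : smooth_near (fun s => TRdual L (g s) (dE_dg L E (x s))) t.
  by apply: smooth_near_TRdual_dE_dg => //; auto.
apply: smooth_near_sub; last exact: smooth_near_derive1.
apply: smooth_near_sub; last by apply: smooth_near_coad => //; exact: snu.
apply: smooth_near_add; last by apply: smooth_near_coad => //; exact: sxi.
by apply: smooth_near_sub => //; apply: smooth_near_coad => //; exact: smu.
Qed.

Lemma smooth_near_residual_nu t : a <= t <= b -> smooth_near residual_nu t.
Proof.
move=> tab; have sdn := smooth_near_dnu tab.
have sdm : smooth_near (fun s => dE_dmu E (x s)) t.
  by apply: smooth_near_dE_dmu => //; auto.
exact: (smooth_near_sub (smooth_near_add sdm (smooth_near_ad (sxi tab) sdn))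
  (smooth_near_derive1 sdn)).
Qed.

Lemma first_variation eta lambda X :
  smooth_curve a b eta -> smooth_curve a b lambda ->
  eta a = 0 -> eta b = 0 -> lambda a = 0 -> lambda b = 0 ->
  is_deformation L a b g mu xi nu eta lambda X ->
  is_derive (0 : R) 1 (fun eps => action E a b (X eps))
    (\int[mleb]_(t in `[a, b])
      (pairing (residual_xi t) (eta t) + pairing (lambda t) (residual_nu t))).
Proof.
move=> heta hlambda etaa etab la lb defX.
pose F (q : R * R) := E (X q.1 q.2).
have dF t (tab : a <= t <= b) := deformation_derivative hE
  (deformation_smooth defX tab) (deformation_0 defX tab) (deformation_g defX tab)
  (deformation_mu defX tab) (deformation_xi defX tab) (deformation_nu defX tab).
have sF t : a <= t <= b -> smooth_near F (0, t) by move=> /dF[].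
have D := derive_under_Rintegral sF.
suff <- : \int[mleb]_(t in `[a, b]) 'd F (0, t) (1, 0) =
   \int[mleb]_(t in `[a, b])
     (pairing (residual_xi t) (eta t) + pairing (lambda t) (residual_nu t)) by exact: D.
(* The boundary term: its derivative contains exactly the terms of the variation in which eta and
   lambda are differentiated. *)
pose P s := pairing (dE_dxi E (x s)) (eta s) + pairing (lambda s) (dE_dnu E (x s)).
have seta t : a <= t <= b -> smooth_near eta t by move=> /heta/smooth_at_near.
have slambda t : a <= t <= b -> smooth_near lambda t by move=> /hlambda/smooth_at_near.
have sP t : a <= t <= b -> smooth_near P t.
  move=> tab; apply: smooth_near_add; apply: smooth_near_pairing;
  by [exact: smooth_near_dxi|exact: seta|exact: slambda|exact: smooth_near_dnu].
have dP t : a <= t <= b -> derive1 P t =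
    pairing (dE_dxi E (x t)) (derive1 eta t) +
    pairing (derive1 (fun s => dE_dxi E (x s)) t) (eta t) +
    (pairing (lambda t) (derive1 (fun s => dE_dnu E (x s)) t) +
     pairing (derive1 lambda t) (dE_dnu E (x t))).
  move=> tab.
  have d1 := is_derive_pairing (smooth_near_is_derive (smooth_near_dxi tab))
    (smooth_near_is_derive (seta t tab)).
  have d2 := is_derive_pairing (smooth_near_is_derive (slambda t tab))
    (smooth_near_is_derive (smooth_near_dnu tab)).
  by rewrite derive1E; case: (is_deriveD d1 d2).
have cP : cont_itv a b (derive1 P).
  by move=> t tab; exact: smooth_near_cont (smooth_near_derive1 (sP t tab)).
have P0 s : eta s = 0 -> lambda s = 0 -> P s = 0.
  by move=> e l; rewrite /P e l pairing0r pairing0l addr0.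
have IP : \int[mleb]_(t in `[a, b]) derive1 P t = 0.
  apply: etrans (Rintegral_FTC2 ab cP (fun t tab => smooth_near_is_derive (sP t tab))) _.
  by rewrite P0// P0// subr0.
have cdF : cont_itv a b (fun t => 'd F (0, t) (1, 0)).
  move=> t tab.
  have sdF := smooth_near_d (1 : R, 0 : R) (sF t tab).
  have [dd _] := is_diffP (is_diff_slice2 (smooth_near_diff sdF)).
  exact: differentiable_continuous dd.
(* This is the integration by parts: subtracting a derivative of integral zero makes the integrands
   equal at every t. *)
transitivity (\int[mleb]_(t in `[a, b]) ('d F (0, t) (1, 0) - derive1 P t)).
  rewrite RintegralB//; last 2 first.
  - exact: cont_itv_integrable cdF.
  - exact: cont_itv_integrable cP.
  by rewrite IP subr0.
apply: eq_Rintegral => t; rewrite inE /= in_itv /= => tab.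
have [_ ->] := dF t tab; rewrite dP//.
apply: (variation_pairing (@ad_anti _ _ _ L) pairing_coad).
by move=> v; apply: pairing_dual_map => c u w; exact: linearP.
Qed.

End EulerLagrange.

(** * Realizing prescribed variations by deformations *)

Section Converse.
Variables (R : realType) (n : nat) (G : topGroupType) (L : lieGroup R n G).
Local Notation lie := 'rV[R]_n.
Local Notation dlie := 'cV[R]_n.
Let okL := lie_charts_ok L.
Let idV V := @id_charts_ok R V.
Local Notation e0 := (chart L 1%g 1%g).

(** The inverse chart replaces the exponential map in the group slot, so the construction is
    available in every Lie group. The inverse chart is meaningful only near the base point, which
    suffices because smoothness is required at eps = 0 alone. *)
Definition affine_deformation (g : R -> G) (mu : R -> dlie) (xi : R -> lie)
    (nu : R -> dlie) (eta : R -> lie) (dmu : R -> dlie) (dxi : R -> lie)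
    (dnu : R -> dlie) (eps t : R) : TTdual R n G :=
  ((chart_inv L 1 (e0 + eps *: eta t) * g t)%g, mu t + eps *: dmu t,
   xi t + eps *: dxi t, nu t + eps *: dnu t).

Lemma smooth_near_affine (V : normedModType R) (u v : R -> V) t :
  smooth_near u t -> smooth_near v t ->
  smooth_near (fun q : R * R => u q.2 + q.1 *: v q.2) (0, t).
Proof.
move=> su sv; have s2 := smooth_near_snd (0 : R, t).
apply: smooth_near_add; first exact: (smooth_near_comp s2 su).
apply: smooth_near_scale; first exact: smooth_near_fst.
exact: (smooth_near_comp s2 sv).
Qed.

Lemma is_derive_affine (V : normedModType R) (u v : V) (s : R) :
  is_derive s 1 (fun eps => u + eps *: v) v.
Proof.
have H := is_diff_linear_comb 1 (is_diff_scale (is_diff_id s) (is_diff_cst v s))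
  (is_diff_cst u s).
have -> : (fun eps => u + eps *: v) = (fun eps => 1 *: (id eps *: cst v eps) + cst u eps).
  by apply/funext => eps; rewrite scale1r addrC.
apply: is_derive_eq (is_diff_is_derive1 H) _.
by rewrite !fctE !scaler0 add0r addr0 !scale1r.
Qed.

(** The inverse chart has the identity as tangent map at the base point, so the velocity [eta] of
    the line reaches h through T_eR_h alone. *)
Lemma velocity_translate (eta : lie) (h : G) :
  velocity L (fun eps : R => (chart_inv L 1 (e0 + eps *: eta) * h)%g) 0 = TR L h eta.
Proof.
pose u (eps : R) := e0 + eps *: eta.
have su : smooth_at (id_charted R) (id_charted lie) u 0.
  apply/smooth_at_near; apply: smooth_near_add; first exact: smooth_near_cst.
  by apply: smooth_near_scale; [exact: smooth_near_id|exact: smooth_near_cst].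
have u0 : u 0 = e0 by rewrite /u scale0r addr0.
have sgi : smooth_at (id_charted lie) L (chart_inv L 1%g) (u 0).
  by rewrite u0; exact: smooth_at_chart_inv.
have sgu := smooth_at_comp (fd := finite_dim_matrix R 1 n) (idV R) (idV _) su sgi.
have gu0 : (chart_inv L 1%g \o u) 0 = 1%g by rewrite /= u0 chart_inv_one.
have sR : smooth_at L L (fun h' : G => (h' * h)%g) ((chart_inv L 1%g \o u) 0).
  by apply: smooth_at_mul => //; [exact: smooth_at_id_G|exact: smooth_at_cst].
have E1 := tangent_comp (idV R) okL (1 : R) sgu sR.
have E2 := tangent_comp (idV R) (idV _) (1 : R) su sgi.
have E3 : tangent (id_charted R) (id_charted lie) u 0 1 = eta.
  have [_] := is_diffP (is_derive_diff (is_derive_affine e0 eta 0)).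
  by move=> /(_ 1); rewrite scale1r.
apply: etrans E1 _; rewrite E2 E3 gu0 u0.
by rewrite tangent_chart_inv.
Qed.

Lemma affine_deformation_smooth g mu xi nu eta dmu dxi dnu t :
  smooth_at (id_charted R) L g t -> smooth_near mu t -> smooth_near xi t ->
  smooth_near nu t -> smooth_near eta t -> smooth_near dmu t ->
  smooth_near dxi t -> smooth_near dnu t ->
  smooth_at (id_charted (R * R)%type) (TTdual_charts L)
    (fun q : R * R => affine_deformation g mu xi nu eta dmu dxi dnu q.1 q.2) (0, t).
Proof.
move=> sg smu sxi snu seta sdmu sdxi sdnu.
have su : smooth_at (id_charted (R * R)%type) (id_charted lie)
    (fun q : R * R => e0 + q.1 *: eta q.2) (0, t).
  by apply/smooth_at_near; apply: (smooth_near_affine (u := cst e0)) => //;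
    exact: smooth_near_cst.
have sgi : smooth_at (id_charted lie) L (chart_inv L 1%g)
  (e0 + (0 : R, t).1 *: eta (0 : R, t).2).
  by rewrite /= scale0r addr0; exact: smooth_at_chart_inv.
have s1 := smooth_at_comp (fd := finite_dim_matrix R 1 n) (idV _) (idV _) su sgi.
have s2 : smooth_at (id_charted (R * R)%type) (id_charted R) (snd : R * R -> R) (0, t).
  by apply/smooth_at_near; exact: smooth_near_snd.
have s3 := smooth_at_comp (fd := finite_dim_real R) (idV _) (idV _) s2 sg.
exact: (smooth_at_pair (smooth_at_pair (smooth_at_pair (smooth_at_mul (idV _) s1 s3)
  (iffRL (smooth_at_near _ _) (smooth_near_affine smu sdmu)))
  (iffRL (smooth_at_near _ _) (smooth_near_affine sxi sdxi)))
  (iffRL (smooth_at_near _ _) (smooth_near_affine snu sdnu))).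
Qed.

(** Every smooth pair of test curves is realized, so extremality can be exploited for the pair built
    from the residuals. *)
Lemma is_deformation_affine (a b : R) g mu xi nu eta lambda :
  smooth_group_curve L a b g -> smooth_curve a b mu -> smooth_curve a b xi ->
  smooth_curve a b nu -> smooth_curve a b eta -> smooth_curve a b lambda ->
  is_deformation L a b g mu xi nu eta lambda
    (affine_deformation g mu xi nu eta
      (fun t => lambda t + coad L (eta t) (mu t))
      (fun t => derive1 eta t + ad L (eta t) (xi t))
      (fun t => derive1 lambda t + coad L (eta t) (nu t) - coad L (xi t) (lambda t))).
Proof.
move=> hg hmu hxi hnu heta hlambda; split=> t tab.
- have /smooth_at_near smu := hmu t tab; have /smooth_at_near sxi := hxi t tab.
  have /smooth_at_near snu := hnu t tab; have /smooth_at_near seta := heta t tab.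
  have /smooth_at_near sla := hlambda t tab.
  apply: affine_deformation_smooth => //; first exact: hg.
  + exact: (smooth_near_add sla (smooth_near_coad L seta smu)).
  + exact: (smooth_near_add (smooth_near_derive1 seta) (smooth_near_ad L seta sxi)).
  + exact: (smooth_near_sub (smooth_near_add (smooth_near_derive1 sla)
      (smooth_near_coad L seta snu)) (smooth_near_coad L sxi sla)).
- by rewrite /affine_deformation !scale0r !addr0 chart_inv_one mul1g.
- exact: velocity_translate.
- exact: is_derive_affine.
- exact: is_derive_affine.
- exact: is_derive_affine.
Qed.

End Converse.

Theorem proposition6p22 (R : realType) (n : nat) (G : topGroupType)
    (L : lieGroup R n G) (E : TTdual R n G -> R) (hE : smooth_lagrangian L E)
    (a b : R) (hab : a < b)
    (g : R -> G) (mu : R -> 'cV[R]_n) (xi : R -> 'rV[R]_n) (nu : R -> 'cV[R]_n)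
    (hg : smooth_group_curve L a b g) (hmu : smooth_curve a b mu)
    (hxi : smooth_curve a b xi) (hnu : smooth_curve a b nu)
    (hgdot : forall t, a <= t <= b -> velocity L g t = TR L (g t) (xi t))
    (hmudot : forall t, a <= t <= b ->
       is_derive t 1 mu (nu t + coad L (xi t) (mu t))) :
  let x := fun t : R => (g t, mu t, xi t, nu t) : TTdual R n G in
  is_extremal L E a b g mu xi nu <->
  (forall t, a <= t <= b ->
     is_derive t 1 (fun s => dE_dxi E (x s))
       (TRdual L (g t) (dE_dg L E (x t))
        - coad L (dE_dmu E (x t)) (mu t)
        + coad L (xi t) (dE_dxi E (x t))
        - coad L (dE_dnu E (x t)) (nu t)) /\
     is_derive t 1 (fun s => dE_dnu E (x s))
       (dE_dmu E (x t) + ad L (xi t) (dE_dnu E (x t)))).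
Proof.
move=> x; split=> [ext t tab|EL].
  pose w (t : R) := (t - a) * (b - t).
  have sw (s : R) : smooth_near w s.
    apply: (smooth_near_scale (f := fun t => t - a) (g := fun t => b - t)).
      by apply: smooth_near_sub; [exact: smooth_near_id|exact: smooth_near_cst].
    by apply: smooth_near_sub; [exact: smooth_near_cst|exact: smooth_near_id].
  have srx s (sab : a <= s <= b) := smooth_near_residual_xi hE hg hmu hxi hnu sab.
  have srn s (sab : a <= s <= b) := smooth_near_residual_nu hE hg hmu hxi hnu sab.
  set rx := residual_xi L E g mu xi nu in srx.
  set rn := residual_nu L E g mu xi nu in srn.
  (* The residual of the xi-equation is a covector while eta is a vector, and the other way round
     for lambda; hence the transposes. *)
  pose eta s := w s *: (rx s)^T; pose lambda s := w s *: (rn s)^T.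
  have heta : smooth_curve a b eta.
    move=> s sab; apply/smooth_at_near; apply: smooth_near_scale => //.
    exact: smooth_near_trmx (srx s sab).
  have hlambda : smooth_curve a b lambda.
    move=> s sab; apply/smooth_at_near; apply: smooth_near_scale => //.
    exact: smooth_near_trmx (srn s sab).
  have wa : w a = 0 by rewrite /w subrr mul0r.
  have wb : w b = 0 by rewrite /w subrr mulr0.
  have etaa : eta a = 0 by rewrite /eta wa scale0r.
  have etab : eta b = 0 by rewrite /eta wb scale0r.
  have la : lambda a = 0 by rewrite /lambda wa scale0r.
  have lb : lambda b = 0 by rewrite /lambda wb scale0r.
  have defX := is_deformation_affine hg hmu hxi hnu heta hlambda.
  (* [D1] and [D2] give two values for the same derivative of the action at 0, so the integral of
     the first variation is zero. *)
  have [_ D1] := ext eta lambda heta hlambda etaa etab la lb _ defX.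
  have [_ D2] := first_variation hE hab hg hmu hxi hnu heta hlambda etaa etab la lb defX.
  have I0 := etrans (esym D2) D1.
  pose q s := pairing (rx s) (rx s)^T + pairing (rn s)^T (rn s).
  have sq s : a <= s <= b -> smooth_near q s.
    move=> sab; have sx := srx s sab; have sn := srn s sab.
    apply: smooth_near_add; apply: smooth_near_pairing => //; exact: smooth_near_trmx.
  have DE s : pairing (rx s) (eta s) + pairing (lambda s) (rn s) = w s * q s.
    by rewrite /eta /lambda pairingZr pairingZl -mulrDr.
  have nn (alpha : 'rV[R]_n) : 0 <= pairing alpha^T alpha.
    by have := pairing_tr_ge0 alpha^T; rewrite trmxK.
  have q0 s : 0 <= q s by rewrite addr_ge0 ?pairing_tr_ge0 ?nn.
  have w0 s : a <= s <= b -> 0 <= w s.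
    by move=> /andP[as_ sb]; rewrite mulr_ge0 ?subr_ge0.
  have wq s : a <= s <= b -> w s * q s = 0.
    apply: (Rintegral_eq0_ge0 hab (f := fun s => w s * q s)).
    - move=> r rab; exact: smooth_near_cont (smooth_near_scale (sw r) (sq r rab)).
    - by move=> r rab; rewrite mulr_ge0 ?w0.
    - by apply: etrans I0; apply: eq_Rintegral => r _; rewrite -DE.
  have cq : cont_itv a b q by move=> r rab; exact: smooth_near_cont (sq r rab).
  (* The weight can be cancelled only inside the interval; its two zeros are left to continuity of
     [q]. *)
  have qI s : a < s < b -> q s = 0.
    move=> /andP[as_ sb]; have sab : a <= s <= b by rewrite !ltW.
    have /eqP := wq s sab; rewrite mulf_eq0 => /orP[|/eqP//].
    by rewrite mulf_eq0 !subr_eq0 (gt_eqF as_) (gt_eqF sb).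
  have /eqP := cont_itv_eq0 hab cq qI tab.
  rewrite paddr_eq0 ?pairing_tr_ge0 ?nn// => /andP[/eqP rx0 /eqP rn0].
  have {}rx0 := pairing_tr_eq0 rx0.
  have {}rn0 : rn t = 0.
    by rewrite -[rn t]trmxK (pairing_tr_eq0 (alpha := (rn t)^T)) ?trmxK ?trmx0.
  split.
    (* Smoothness supplies a derivative of each momentum, and the vanishing residual identifies its
       value. *)
    apply: is_derive_eq (smooth_near_is_derive (smooth_near_dxi hE hg hmu hxi hnu tab)) _.
    exact/esym/subr0_eq.
  apply: is_derive_eq (smooth_near_is_derive (smooth_near_dnu hE hg hmu hxi hnu tab)) _.
  exact/esym/subr0_eq.
move=> eta lambda heta hlambda etaa etab la lb X defX.
have D := first_variation hE hab hg hmu hxi hnu heta hlambda etaa etab la lb defX.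
apply: is_derive_eq D _.
have Z : \int[@lebesgue_measure R]_(t in `[a, b]) (0 : R) = 0.
  by rewrite Rintegral_cst ?mul0r.
(* The equations make both residuals vanish on [a, b], so the integrand is zero whatever the
   deformation. *)
apply: etrans _ Z; apply: eq_Rintegral => t; rewrite inE /= in_itv /= => tab.
have [[_ D1] [_ D2]] := EL t tab.
have -> : residual_xi L E g mu xi nu t = 0.
  by rewrite /residual_xi derive1E D1 subrr.
have -> : residual_nu L E g mu xi nu t = 0.
  by rewrite /residual_nu derive1E D2 subrr.
by rewrite pairing0l pairing0r addr0.
Qed.
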